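(* There exist absolute constants $C_1, C_2, \eta^*>0$ such that for every $0<\eta\le\eta^*$, setting $\lambda = \mathrm{e}^{-1}+\eta$, $$\lim_{n\to\infty}\mathbb{P}\Big(n\,\mathrm{e}^{-C_1/\sqrt{\eta}} \le L(n,\lambda) \le n\,\mathrm{e}^{-C_2/\sqrt{\eta}}\Big) = 1.$$
   Context: Let $\mathcal W_n$ be the complete graph on $n$ vertices in which each edge $e$ carries an independent weight $W_e$ that is exponentially distributed with mean $n$. A path $\pi=(v_0,v_1,\dots,v_m)$ is a tuple of distinct vertices; its length is $len(\pi)=m$ and its average weight is $A(\pi)=\frac1m\sum_{i=1}^m W_{(v_{i-1},v_i)}$. For $\lambda>0$, $L(n,\lambda)=\max\{len(\pi): \pi \text{ a path in } \mathcal W_n,\ A(\pi)\le\lambda\}$. *)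

(* Defs.v *)
From HB Require Import structures.
From mathcomp Require Import all_boot all_order all_algebra.
From mathcomp Require Import all_classical all_reals all_analysis.
Set Implicit Arguments. Unset Strict Implicit. Unset Printing Implicit Defensive.
Import Order.TTheory GRing.Theory Num.Theory.
Local Open Scope classical_set_scope.
Local Open Scope ring_scope.

(* Edges of the complete graph K_n on vertex set 'I_n: unordered pairs {i,j},
   i <> j, represented canonically by ordered pairs (i, j) with i < j. *)
Definition edge (n : nat) := {p : 'I_n * 'I_n | (nat_of_ord p.1 < nat_of_ord p.2)%N}.

(* Weight W_{(i,j)} of the unordered edge {i,j}, given the edge weights w.
   (The value for i = j is irrelevant: paths have distinct vertices.) *)
Definition ew (R : realType) (n : nat) (w : edge n -> R) (i j : 'I_n) : R :=
  match (insub (i, j) : option (edge n)) with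
  | Some e => w e
  | None =>
    match (insub (j, i) : option (edge n)) with
    | Some e => w e
    | None => 0
    end
  end.

Fixpoint path_weight (R : realType) (n : nat) (w : edge n -> R)
    (s : seq 'I_n) : R :=
  match s with
  | x :: ((y :: _) as t) => ew w x y + path_weight w t
  | _ => 0
  end.

(* L(n, lambda): the maximal length m of a path (v_0,...,v_m) of distinct
   vertices of K_n (so m <= n - 1) with m >= 1 and average weight
   A = (1/m) * sum W <= lambda; 0 if there is no such path. *)
Definition Lmax (R : realType) (n : nat) (w : edge n -> R) (lam : R) : nat :=
  (\max_(m < n)
     \max_(p : m.+1.-tuple 'I_n |
             [&& uniq p, (0 < (m : nat))%N &
                 (path_weight w p / (m : nat)%:R <= lam)%R])
       (m : nat))%N.

Definition mutually_independent (d : measure_display) (T : measurableType d)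
    (R : realType) (P : probability T R) (I : finType)
    (X : I -> {RV P >-> R}) : Prop :=
  forall (J : {set I}) (B : I -> set R),
    (forall i, measurable (B i)) ->
    P (\bigcap_(i in [set i | i \in J]) (X i @^-1` B i)) =
      (\prod_(i in J) P (X i @^-1` B i))%E.

(* X is exponentially distributed with mean mu (rate 1/mu). *)
Definition exp_distributed (d : measure_display) (T : measurableType d)
    (R : realType) (P : probability T R) (X : {RV P >-> R}) (mu : R) : Prop :=
  forall A : set R, measurable A ->
    P (X @^-1` A) = exponential_prob mu^-1 A.

(* Main.v *)
(* Weights are rounded down to multiples of 1/N, which makes every event a
   finite combinatorial one: an edge takes a given value with probability about
   1/(N n), so the expected number of paths whose label sequence lies in a set
   is at most the corresponding count divided by powers of N.  Write
   z = 1 / sqrt eta and follow S_k - l k along a path, l being about N lambda.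

   Both bounds rest on one kernel computation.  For r = sin(l t) / sin((l+1) t)
   the functions r^y sin(t (y + a)) sum in closed form, hence are exact super-
   or subsolutions for the walk killed outside a tube of width about pi / t,
   with growth rate about (1 + e eta)(1 - t^2 l^2 / 2) per step.

   Upper bound: in a tube of width c N z with c small the growth rate is below
   1.  A path of average at most lambda, cut into segments of about z^3 steps,
   must have a positive fraction of "low" segments, which either stay in the
   tube or leave it through its bottom; the expected number of these started at
   a vertex is exp(- C z), and a union bound over families of vertex-disjoint
   low segments shows that there are at most n exp(- C' z) of them.

   Lower bound: in a tube of width C N z with C large the growth rate exceeds 1.
   Run a depth-first search whose stack is a path staying in the tube.  The sum
   over the stack of the subsolution, discounted by the fraction of edges
   already revealed, minus a small multiple of the number of visited vertices,
   has positive drift; exp of minus it is a supermartingale, so when a small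
   fraction of the vertices has been visited the stack has length of order
   n exp(- C z) with overwhelming probability. *)
Require Import Defs.
From HB Require Import structures.
From mathcomp Require Import all_boot all_order all_algebra.
From mathcomp Require Import all_classical all_reals all_analysis measurable_realfun.
From mathcomp Require Import ring lra zify.
Set Implicit Arguments. Unset Strict Implicit. Unset Printing Implicit Defensive.
Import Order.TTheory GRing.Theory Num.Theory numFieldNormedType.Exports.
Local Open Scope classical_set_scope.
Local Open Scope ring_scope.

(** * Trigonometric inequalities *)

Section Trigonometry.
Context {R : realType}.
Implicit Types (t a b : R).

Lemma ge0_of_derive_ge0 (f df : R -> R) t :
  (forall x : R^o, is_derive x (1 : R^o) f (df x)) -> f 0 = 0 ->
  (forall x, 0 < x < t -> 0 <= df x) -> 0 <= t -> 0 <= f t.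
Proof.
move=> fd f0 df0; rewrite le_eqVlt => /predU1P[<-|t0]; first by rewrite f0.
have ft : {within `[0, t], continuous (f : R^o -> R^o)}.
  apply: continuous_subspaceT => x.
  by apply: differentiable_continuous; apply/derivable1_diffP; case: (fd x).
have [x xt] := MVT t0 (fun x _ => fd x) ft.
rewrite f0 !subr0 => ->; apply: mulr_ge0; last exact: ltW.
by apply: df0; move: xt; rewrite in_itv.
Qed.

Lemma mul_cos_le_sin t : 0 <= t <= pi -> t * cos t <= sin t.
Proof.
move=> /andP[t0 tpi]; rewrite -subr_ge0.
apply: (@ge0_of_derive_ge0 (fun t => sin t - t * cos t) (fun t => t * sin t)) => //.
- move=> x; apply: is_derive_eq.
  rewrite /GRing.scale /=; ring.
- by rewrite sin0 mul0r subrr.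
- move=> x /andP[x0 xt]; apply: mulr_ge0; first exact: ltW.
  by rewrite sin_ge0_pi// (ltW x0) (le_trans (ltW xt)).
Qed.

(** The derivative of the difference is [t (sin t / 2 - t cos t / 4)], nonnegative by the previous
    bound. The gain [t ^+ 2 / 4] is what later pushes the growth rate in a narrow tube below 1. *)
Lemma mul_cos_le_quadratic_sin t :
  0 <= t <= pi -> t * cos t <= (1 - t ^+ 2 / 4) * sin t.
Proof.
move=> /andP[t0 tpi]; rewrite -subr_ge0.
apply: (@ge0_of_derive_ge0 (fun t => (1 - t ^+ 2 / 4) * sin t - t * cos t)
  (fun t => t * (sin t / 2 - t * cos t / 4))) => //.
- move=> x; apply: is_derive_eq.
  rewrite /GRing.scale /=; by field.
- by rewrite sin0 mulr0 mul0r subrr.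
- move=> x /andP[x0 xt]; apply: mulr_ge0; first exact: ltW.
  have xpi : 0 <= x <= pi by rewrite (ltW x0) (le_trans (ltW xt)).
  have := mul_cos_le_sin xpi; have := sin_ge0_pi xpi; lra.
Qed.

Lemma sin_le_id t : 0 <= t -> sin t <= t.
Proof.
move=> t0; rewrite -subr_ge0.
apply: (@ge0_of_derive_ge0 (fun t => t - sin t) (fun t => 1 - cos t)) => //.
  by rewrite sin0 subrr.
Qed.

Lemma cos_ge_quadratic t : 1 - t ^+ 2 / 2 <= cos t.
Proof.
wlog t0 : t / 0 <= t.
  move=> H; have [/H//|/ltW t0] := leP 0 t.
  by rewrite -(cosN t) -sqrrN; apply: H; rewrite oppr_ge0.
rewrite -subr_ge0.
apply: (@ge0_of_derive_ge0 (fun t => cos t - (1 - t ^+ 2 / 2)) (fun t => t - sin t)) => //.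
- move=> x; apply: is_derive_eq; rewrite /GRing.scale /=; by field.
- by rewrite cos0 expr0n /= mul0r subr0 subrr.
- by move=> x /andP[x0 _]; rewrite subr_ge0 sin_le_id// ltW.
Qed.

Lemma sin_ge_cubic t : 0 <= t <= pi -> t * (1 - t ^+ 2 / 2) <= sin t.
Proof.
move=> tpi; apply: le_trans (mul_cos_le_sin tpi).
by apply: ler_wpM2l; [case/andP: tpi|exact: cos_ge_quadratic].
Qed.

Lemma sin_natmul_le t n : 0 <= t -> n%:R * t <= pi -> sin (n.+1%:R * t) <= n.+1%:R * sin t.
Proof.
move=> t0; elim: n => [|n ih] nt; first by rewrite !mul1r.
have nt' : n%:R * t <= pi.
  by apply: le_trans nt; rewrite ler_wpM2r// ler_nat.
have -> : n.+2%:R = n.+1%:R + 1 :> R by rewrite -[n.+2]addn1 natrD.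
rewrite !mulrDl !mul1r sinD.
apply: lerD.
  apply: le_trans (ih nt'); rewrite -[leRHS]mulr1.
  apply: ler_wpM2l; last exact: cos_le1.
  by rewrite sin_ge0_pi// nt mulr_ge0.
rewrite -[leRHS]mul1r; apply: ler_wpM2r; last exact: cos_le1.
rewrite sin_ge0_pi// t0/=; apply: le_trans nt.
by rewrite -[leLHS]mul1r ler_wpM2r// ler1n.
Qed.

End Trigonometry.

(** * Sine eigenfunctions of the killed walk *)

Section Kernel.
Context {R : realType}.
Variables (l : nat) (th : R).
Hypotheses (l0 : (0 < l)%N) (th0 : 0 < th) (thpi : l.+1%:R * th < pi).

Definition tilt : R := sin (l%:R * th) / sin (l.+1%:R * th).
Definition amplitude : R := sin (l.+1%:R * th) / sin th.
(** As [amplitude] is [1 / |1 - tilt e^(i th)|], this is the formal eigenvalue, on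
    [tilt ^ y * sin (y th + phi)], of the kernel with unit mass on each step [k - l], [k >= 0].
    Divided by [N] it is the growth rate per step. *)
Definition growth : R := amplitude / tilt ^+ l.

Let sin_l : 0 < sin (l%:R * th).
Proof.
apply: sin_gt0_pi; rewrite mulr_gt0 ?ltr0n//=.
by apply: lt_trans thpi; rewrite ltr_pM2r// ltr_nat.
Qed.

Let sin_Sl : 0 < sin (l.+1%:R * th).
Proof. by apply: sin_gt0_pi; rewrite thpi mulr_gt0. Qed.

Let sin_1 : 0 < sin th.
Proof.
apply: sin_gt0_pi; rewrite th0; apply: le_lt_trans thpi.
by rewrite -[leLHS]mul1r ler_wpM2r ?ler1n// ltW.
Qed.

Lemma tilt_gt0 : 0 < tilt. Proof. exact: divr_gt0. Qed.

Lemma amplitude_gt0 : 0 < amplitude. Proof. exact: divr_gt0. Qed.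

Lemma growth_gt0 : 0 < growth.
Proof. by rewrite divr_gt0 ?exprn_gt0 ?tilt_gt0 ?amplitude_gt0. Qed.

(* The geometric tail sum of [tilt ^ y * sin (phi + y th)], in closed form
   because [tilt] makes the argument of [1 - tilt e^(i th)] equal to [- l th]. *)
Lemma tilt_telescope (phi : R) y :
  tilt ^+ y * sin phi = amplitude * (tilt ^+ y * sin (phi + l%:R * th))
    - amplitude * (tilt ^+ y.+1 * sin (phi + th + l%:R * th)).
Proof.
suff E : sin phi = amplitude * sin (phi + l%:R * th)
    - amplitude * (tilt * sin (phi + th + l%:R * th)).
  by rewrite [in LHS]E exprS; ring.
rewrite /amplitude /tilt.
have st := lt0r_neq0 sin_1; have sl := lt0r_neq0 sin_Sl.
apply: (mulfI st); rewrite mulrBr.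
have -> : sin th * (sin (l.+1%:R * th) / sin th * sin (phi + l%:R * th)) =
  sin (l.+1%:R * th) * sin (phi + l%:R * th) by field.
have -> : sin th * (sin (l.+1%:R * th) / sin th * (sin (l%:R * th) /
  sin (l.+1%:R * th) * sin (phi + th + l%:R * th))) =
  sin (l%:R * th) * sin (phi + th + l%:R * th) by field; rewrite st sl.
rewrite -natr1 mulrDl mul1r !sinD !cosD.
have := cos2Dsin2 (l%:R * th); set A := l%:R * th => /eqP.
rewrite -subr_eq0 => /eqP E.
apply/eqP; rewrite -subr_eq0; apply/eqP.
transitivity (- sin th * sin phi * (cos A ^+ 2 + sin A ^+ 2 - 1)); first by ring.
by rewrite E mulr0.
Qed.

Lemma sum_tilt_sin (phi : R) y m :
  \sum_(k < m) tilt ^+ (y + k) * sin (phi + k%:R * th) =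
  amplitude * (tilt ^+ y * sin (phi + l%:R * th))
    - amplitude * (tilt ^+ (y + m) * sin (phi + m%:R * th + l%:R * th)).
Proof.
elim: m => [|m ih]; first by rewrite big_ord0 addn0 mul0r addr0 subrr.
rewrite big_ord_recr/= ih (tilt_telescope (phi + m%:R * th) (y + m)) addnS -natr1 mulrDl mul1r !addrA.
ring.
Qed.

Lemma growth_tilt y (phi : R) : (l <= y)%N ->
  amplitude * (tilt ^+ (y - l) * phi) = growth * (tilt ^+ y * phi).
Proof.
move=> ly; rewrite /growth -{2}(subnK ly) exprD; field.
by rewrite expf_neq0// lt0r_neq0// tilt_gt0.
Qed.

(** Extending the sum down to height [x - l] only adds nonnegative terms, the sine being nonnegative
    on all of [[0, H + 2 l + 1]]. The remainder of the closed form then has phase exactly [pi] and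
    vanishes. *)
Lemma kernel_tube_le H J x : (H + l.*2.+1)%:R * th = pi -> (l < x <= l + H)%N ->
  (l + H <= J)%N ->
  \sum_(k < J | (l < x - l + k <= l + H)%N)
     tilt ^+ (x - l + k) * sin ((x - l + k)%:R * th) <=
  growth * (tilt ^+ x * sin (x%:R * th)).
Proof.
move=> Hpi /andP[lx xH] HJ.
pose u k := tilt ^+ (x - l + k) * sin ((x - l + k)%:R * th).
have u0 k : (x - l + k <= l + H)%N -> 0 <= u k.
  move=> kH; rewrite mulr_ge0 ?exprn_ge0 ?(ltW tilt_gt0)//.
  rewrite sin_ge0_pi//; apply/andP; split; first by rewrite mulr_ge0// ltW.
  by rewrite -Hpi ler_pM2r// ler_nat; lia.
pose m := (l + H - (x - l)).+1.
apply: (@le_trans _ _ (\sum_(k < m) u k)).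
  rewrite (big_ord_widen J u); last by rewrite /m; lia.
  rewrite big_mkcond [leRHS]big_mkcond/=; apply: ler_sum => k _.
  case: ifP => [/andP[_ kH]|_]; first by rewrite ifT// /m; lia.
  by case: ifP => // km; apply: u0; rewrite /m in km; lia.
rewrite (eq_bigr (fun k : 'I_m => tilt ^+ (x - l + k) *
  sin ((x - l)%:R * th + k%:R * th))); last first.
  by move=> k _; rewrite /u natrD mulrDl.
rewrite sum_tilt_sin -!mulrDl -!natrD subnK ?(ltnW lx)//.
rewrite growth_tilt ?(ltnW lx)// (_ : x - l + m + l = H + l.*2.+1)%N; last first.
  by rewrite /m; lia.
by rewrite Hpi sinpi !mulr0 subr0.
Qed.

(** Now the sine vanishes at heights [l] and [l + B]: terms at heights up to [l] are nonpositive and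
    may be dropped, and the subtracted remainder has phase [pi + l th], where the sine is
    negative. *)
Lemma kernel_tube_ge B J x : B%:R * th = pi -> (l < x < l + B)%N ->
  (l + B <= J)%N ->
  growth * (tilt ^+ x * sin ((x%:R - l%:R) * th)) <=
  \sum_(k < J | (l < x - l + k < l + B)%N)
     tilt ^+ (x - l + k) * sin (((x - l + k)%:R - l%:R) * th).
Proof.
move=> Bpi /andP[lx xB] BJ.
have lB : (l < B)%N.
  rewrite -(ltr_nat R) -(ltr_pM2r th0) Bpi; apply: le_lt_trans thpi.
  by rewrite ler_pM2r// ler_nat.
pose u k := tilt ^+ (x - l + k) * sin (((x - l + k)%:R - l%:R) * th).
pose m := (l + B - (x - l))%N.
apply: (@le_trans _ _ (\sum_(k < m) u k)); last first.
  rewrite (big_ord_widen J u); last by rewrite /m; lia.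
  rewrite big_mkcond [leRHS]big_mkcond/=; apply: ler_sum => k _.
  case: ifP => [km|km]; last by rewrite ifF// /m; rewrite /m in km; lia.
  case: ifP => // kl; have {}kl : (x - l + k <= l)%N by rewrite /m in km; lia.
  rewrite mulr_ge0_le0 ?exprn_ge0 ?(ltW tilt_gt0)//.
  rewrite -opprB mulNr sinN oppr_le0 sin_ge0_pi//.
  rewrite -natrB//; apply/andP; split; first by rewrite mulr_ge0// ltW.
  by rewrite -Bpi ler_pM2r// ler_nat; lia.
rewrite (eq_bigr (fun k : 'I_m => tilt ^+ (x - l + k) *
  sin (((x - l)%:R - l%:R) * th + k%:R * th))); last first.
  by move=> k _; rewrite /u natrD -mulrDl; congr (_ * sin (_ * _)); ring.
rewrite sum_tilt_sin -!mulrDl.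
rewrite (_ : (x - l)%:R - l%:R + l%:R = x%:R - l%:R); last first.
  by rewrite natrB ?(ltnW lx)//; ring.
rewrite growth_tilt ?(ltnW lx)// lerDl oppr_ge0.
rewrite mulr_ge0_le0 ?(ltW amplitude_gt0)// mulr_ge0_le0 ?exprn_ge0 ?(ltW tilt_gt0)//.
rewrite -addrA (_ : ((x - l)%:R - l%:R + _) * th = l%:R * th + pi); last first.
  rewrite -Bpi -mulrDl; congr (_ * th).
  rewrite natrB ?(ltnW lx)// /m natrB; last by lia.
  by rewrite natrB ?(ltnW lx)// natrD; ring.
by rewrite sinDpi oppr_le0 ltW.
Qed.

End Kernel.

(** * Estimates for the growth rate *)

Section GrowthBounds.
Context {R : realType}.

Lemma expr1B_ge (x : R) n : 0 <= x <= 1 -> 1 - n%:R * x <= (1 - x) ^+ n.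
Proof.
move=> /andP[x0 x1]; elim: n => [|n ih]; first by rewrite mul0r subr0 expr0.
rewrite exprS -natr1 mulrDl mul1r.
have [h|h] := leP (1 - n%:R * x) 0.
  apply: (@le_trans _ _ 0); first by lra.
  by rewrite mulr_ge0 ?exprn_ge0 ?subr_ge0.
apply: (@le_trans _ _ ((1 - x) * (1 - n%:R * x))); last first.
  by rewrite ler_wpM2l ?subr_ge0.
have : 0 <= n%:R * x * x by rewrite !mulr_ge0.
lra.
Qed.

Lemma expR1_ge2 : 2 <= expR 1 :> R.
Proof. by have := expR_ge1Dx (1 : R); lra. Qed.

Lemma expR1_le4 : expR 1 <= 4 :> R.
Proof.
have := expR_ge1Dx (- (2^-1) : R); rewrite expRN => h.
have e0 := expR_gt0 (2^-1 : R).
have : expR 2^-1 <= 2 :> R.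
  by rewrite -[leLHS]invrK invf_ple ?posrE ?invr_gt0 ?e0 ?ltr0n//; lra.
move=> h2; have -> : expR 1 = expR (2^-1 + 2^-1) :> R by congr expR; field.
by rewrite expRD; nra.
Qed.

(** This is [e <= (1 + 1/l) ^ (l + 1)], which follows from [1 - 1/(l+1) <= exp (- 1/(l+1))]. *)
Lemma expR1_le_natpow l : (0 < l)%N -> expR 1 * l%:R <= l.+1%:R * (1 + l%:R^-1) ^+ l :> R.
Proof.
move=> l0; have lr : 0 < l%:R :> R by rewrite ltr0n.
have E : 1 + l%:R^-1 = l.+1%:R / l%:R :> R by rewrite -natr1; field; rewrite gt_eqF.
have h : expR 1 <= (1 + l%:R^-1) ^+ l.+1 :> R.
  have -> : expR 1 = expR (l.+1%:R^-1) ^+ l.+1 :> R.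
    by rewrite -expRM_natr mulVf.
  rewrite lerXn2r ?nnegrE ?expR_ge0 ?addr_ge0 ?invr_ge0 ?(ltW lr)//.
  have := expR_ge1Dx (- (l.+1%:R^-1) : R); rewrite expRN => h.
  rewrite -[leLHS]invrK invf_ple ?posrE ?invr_gt0 ?expR_gt0 ?addr_gt0 ?invr_gt0 ?lr//.
  apply: le_trans h; rewrite E invf_div -natr1.
  rewrite le_eqVlt; apply/orP; left; apply/eqP; field.
  by rewrite !gt_eqF// ?addr_gt0.
apply: (@le_trans _ _ ((1 + l%:R^-1) ^+ l.+1 * l%:R)).
  by rewrite ler_wpM2r// ltW.
rewrite exprSr -mulrA E divfK ?gt_eqF// mulrC.
by [].
Qed.

Variables (l : nat) (th : R).
Hypotheses (l0 : (0 < l)%N) (th0 : 0 < th) (th1 : l.+1%:R * th <= 1).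

Lemma angle_lt_pi : l.+1%:R * th < pi.
Proof. by apply: le_lt_trans th1 _; apply: lt_le_trans (@pi_ge2 R); rewrite ltr1n. Qed.

Let t := l%:R * th.
Let lr : 0 < l%:R :> R. Proof. by rewrite ltr0n. Qed.
Let t0 : 0 < t. Proof. exact: mulr_gt0. Qed.
Let t1 : t <= 1.
Proof. by apply: le_trans th1; rewrite /t ler_wpM2r ?ler_nat// ltW. Qed.
Let t2 : t ^+ 2 <= 1.
Proof. by rewrite expr_le1// ltW. Qed.
Let tpi : 0 <= t <= pi.
Proof. by rewrite (ltW t0) (le_trans t1)// (le_trans _ (@pi_ge2 R))// ler1n. Qed.
Let tht : th <= t.
Proof. by rewrite -[leLHS]mul1r ler_wpM2r ?ler1n// ltW. Qed.
Let thpi : 0 < th < pi.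
Proof.
rewrite th0 (le_lt_trans tht)// (le_lt_trans t1)//.
by apply: lt_le_trans (@pi_ge2 R); rewrite ltr1n.
Qed.
Let st : 0 < sin t.
Proof.
by apply: sin_gt0_pi; rewrite t0 (le_lt_trans t1)// (lt_le_trans _ (@pi_ge2 R))// ltr1n.
Qed.
Let sth : 0 < sin th. Proof. exact: sin_gt0_pi. Qed.

Let tiltV_E : (tilt l th)^-1 = cos th + sin th * (cos t / sin t).
Proof.
rewrite /tilt invf_div -natr1 mulrDl mul1r sinD -/t; field.
by rewrite gt_eqF.
Qed.

Lemma amplitude_le : amplitude l th <= l.+1%:R.
Proof.
rewrite /amplitude ler_pdivrMr// sin_natmul_le//; first exact: ltW.
by case/andP: tpi.
Qed.

(** In [cos th + sin th * cot t] the first term is at most 1, [sin th] is at most [th], and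
    [t cot t] is at most [1 - t ^+ 2 / 4]. *)
Let tiltV_le_quadratic : (tilt l th)^-1 <= 1 + (1 - t ^+ 2 / 4) / l%:R.
Proof.
rewrite tiltV_E; apply: lerD; first exact: cos_le1.
have -> : (1 - t ^+ 2 / 4) / l%:R = th * ((1 - t ^+ 2 / 4) / t).
  by rewrite /t; field; rewrite !gt_eqF.
apply: ler_pM; [exact: ltW| |exact/sin_le_id/ltW|].
  apply: divr_ge0; last exact: ltW.
  apply: le_trans (cos_ge_quadratic _); have := t2; lra.
rewrite ler_pdivrMr// mulrAC ler_pdivlMr// mulrC.
exact: mul_cos_le_quadratic_sin.
Qed.

Lemma tiltV_le : (tilt l th)^-1 <= 1 + l%:R^-1.
Proof.
apply: (le_trans tiltV_le_quadratic); rewrite lerD2l// -[leRHS]mul1r.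
by rewrite ler_wpM2r ?invr_ge0 ?(ltW lr)//; have := sqr_ge0 t; lra.
Qed.

Lemma tiltV_ge : (1 + l%:R^-1) * (1 - l%:R * th ^+ 2) <= (tilt l th)^-1.
Proof.
have th2 : th ^+ 2 <= 1 by rewrite expr_le1// ?(le_trans tht t1)// ltW.
rewrite tiltV_E.
have h1 : 1 - th ^+ 2 / 2 <= cos th := cos_ge_quadratic th.
have h2 : th * (1 - th ^+ 2 / 2) <= sin th.
  by apply: sin_ge_cubic; case/andP: thpi => /ltW-> /ltW->.
have h3 : (1 - t ^+ 2 / 2) / t <= cos t / sin t.
  apply: ler_pM; [by have := t2; lra|by rewrite invr_ge0 ltW|exact: cos_ge_quadratic|].
  by rewrite lef_pV2 ?posrE// sin_le_id// ltW.
have h4 : th * (1 - th ^+ 2 / 2) * ((1 - t ^+ 2 / 2) / t) <= sin th * (cos t / sin t).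
  apply: ler_pM => //; first by rewrite mulr_ge0 ?(ltW th0)//; have := th2; lra.
  by rewrite divr_ge0 ?(ltW t0)//; have := t2; lra.
apply: le_trans (lerD h1 h4).
have -> : th * (1 - th ^+ 2 / 2) * ((1 - t ^+ 2 / 2) / t) =
  (1 - th ^+ 2 / 2) * (1 - t ^+ 2 / 2) / l%:R.
  by rewrite /t; field; rewrite !gt_eqF.
rewrite -subr_ge0.
have -> : 1 - th ^+ 2 / 2 + (1 - th ^+ 2 / 2) * (1 - t ^+ 2 / 2) / l%:R
  - (1 + l%:R^-1) * (1 - l%:R * th ^+ 2) =
  th ^+ 2 / 2 * (l%:R - 1 + 2 - l%:R^-1 + th ^+ 2 * l%:R / 2).
  by rewrite /t; field; rewrite gt_eqF.
apply: mulr_ge0; first by rewrite divr_ge0 ?sqr_ge0.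
have : l%:R^-1 <= 1 :> R by rewrite invf_le1// ler1n.
have : 1 <= l%:R :> R by rewrite ler1n.
have : 0 <= th ^+ 2 * l%:R / 2 by rewrite divr_ge0// mulr_ge0// sqr_ge0.
lra.
Qed.

Lemma tilt_le1 : tilt l th <= 1.
Proof.
rewrite -[leLHS]invrK invf_le1 ?invr_gt0; last exact: (tilt_gt0 l0 th0 angle_lt_pi).
apply: le_trans tiltV_ge; rewrite -subr_ge0.
have -> : (1 + l%:R^-1) * (1 - l%:R * th ^+ 2) - 1 =
  (1 - t * (l.+1%:R * th)) / l%:R by rewrite /t -natr1; field; rewrite gt_eqF.
rewrite divr_ge0 ?(ltW lr)// subr_ge0 -[leRHS]mul1r ler_pM// ?ltW//.
by rewrite mulr_gt0.
Qed.

Lemma growth_le : growth l th <= l.+1%:R * expR (1 - t ^+ 2 / 4).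
Proof.
have r0 := tilt_gt0 l0 th0 angle_lt_pi.
rewrite /growth; apply: ler_pM.
- exact: (ltW (amplitude_gt0 th0 angle_lt_pi)).
- by rewrite invr_ge0 exprn_ge0// ltW.
- exact: amplitude_le.
have -> : expR (1 - t ^+ 2 / 4) = expR ((1 - t ^+ 2 / 4) / l%:R) ^+ l.
  by rewrite -expRM_natr divfK// gt_eqF.
rewrite -exprVn lerXn2r ?nnegrE ?expR_ge0 ?invr_ge0 ?(ltW r0)//.
exact: le_trans tiltV_le_quadratic (expR_ge1Dx _).
Qed.

(** The amplitude loses a factor [1 - 2 t ^+ 2], because [(l + 1) th <= 2 t], and the power of the
    tilt a factor [1 - t ^+ 2]; the product is at least [1 - 3 t ^+ 2]. *)
Lemma growth_ge : expR 1 * l%:R * (1 - 3 * t ^+ 2) <= growth l th.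
Proof.
have r0 := tilt_gt0 l0 th0 angle_lt_pi.
have [h|h] := leP (1 - 3 * t ^+ 2) 0.
  apply: le_trans (ltW (growth_gt0 l0 th0 angle_lt_pi)).
  by rewrite mulr_ge0_le0// mulr_ge0 ?expR_ge0 ?ltW.
have Sl2 : l.+1%:R * th <= 2 * t.
  by rewrite /t mulrA ler_wpM2r ?(ltW th0)// -natrM ler_nat mul2n -addnn -addn1 leq_add2l.
have Sl0 : 0 < l.+1%:R * th by rewrite mulr_gt0.
have hA : l.+1%:R * (1 - 2 * t ^+ 2) <= amplitude l th.
  rewrite /amplitude ler_pdivlMr//.
  apply: (@le_trans _ _ (l.+1%:R * th * (1 - (l.+1%:R * th) ^+ 2 / 2))); last first.
    by apply: sin_ge_cubic; rewrite (ltW Sl0) (ltW angle_lt_pi).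
  apply: (@le_trans _ _ (l.+1%:R * (1 - 2 * t ^+ 2) * th)).
    by rewrite ler_wpM2l ?sin_le_id ?(ltW th0)// mulr_ge0//; nra.
  by rewrite mulrAC ler_wpM2l ?(ltW Sl0)//; nra.
have hT : (1 + l%:R^-1) ^+ l * (1 - t ^+ 2) <= (tilt l th ^+ l)^-1.
  have lth : 0 <= l%:R * th ^+ 2 <= 1.
    by rewrite mulr_ge0 ?sqr_ge0 ?(ltW lr)//= expr2 mulrA -/t mulr_ile1 ?(ltW t0) ?(ltW th0)// (le_trans tht).
  apply: (@le_trans _ _ (((1 + l%:R^-1) * (1 - l%:R * th ^+ 2)) ^+ l)).
    rewrite [leRHS]exprMn ler_wpM2l ?exprn_ge0 ?addr_ge0 ?invr_ge0 ?(ltW lr)//.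
    by apply: le_trans (expr1B_ge l lth); rewrite /t exprMn mulrA -expr2.
  rewrite -exprVn lerXn2r ?nnegrE ?invr_ge0 ?(ltW r0)//; last exact: tiltV_ge.
  case/andP: lth => _ lth1; rewrite mulr_ge0 ?subr_ge0// addr_ge0// invr_ge0 ltW//.
rewrite /growth.
apply: (@le_trans _ _ ((l.+1%:R * (1 - 2 * t ^+ 2)) * ((1 + l%:R^-1) ^+ l * (1 - t ^+ 2)))); last first.
  apply: ler_pM => //; first by rewrite mulr_ge0//; lra.
  rewrite mulr_ge0 ?subr_ge0// exprn_ge0// addr_ge0// invr_ge0 ltW//.
rewrite mulrACA; apply: ler_pM; last by nra.
- by rewrite mulr_ge0 ?expR_ge0// ltW.
- exact: ltW.
- exact: expR1_le_natpow.
Qed.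

End GrowthBounds.

(** * Finite product spaces *)

Section ProductSpace.
Context {R : realType} {E K : finType} (p : K -> R).
Hypotheses (p0 : forall k, 0 <= p k) (p1 : \sum_k p k = 1).
Implicit Types (A : pred {ffun E -> K}) (S : {set E}) (w : {ffun E -> K}).

Definition product_prob A : R := \sum_(w | A w) \prod_e p (w e).

Lemma product_prob_union (I : finType) A (B : I -> pred {ffun E -> K}) :
  (forall w, A w -> exists i, B i w) ->
  product_prob A <= \sum_i product_prob (B i).
Proof.
move=> AB; rewrite /product_prob.
under [leRHS]eq_bigr do rewrite big_mkcond/=.
rewrite exchange_big/= big_mkcond/=; apply: ler_sum => w _.
have pr0 : 0 <= \prod_e p (w e) by apply: prodr_ge0.
case: ifP => [/AB[i Bi]|_]; last by apply: sumr_ge0 => i _; case: ifP.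
by rewrite (bigD1 i)//= Bi lerDl; apply: sumr_ge0 => j _; case: ifP.
Qed.

(** The constraints amount to a predicate [Q s e] on each coordinate separately, so the sum of
    products becomes a product of sums; distinct coordinates leave at most one constraint on
    each. *)
Lemma product_prob_cylinder (s : seq (E * K)) : uniq [seq ek.1 | ek <- s] ->
  product_prob (fun w => all (fun ek => w ek.1 == ek.2) s) = \prod_(ek <- s) p ek.2.
Proof.
pose Q s e : pred K := fun k => all (fun ek : E * K => (ek.1 == e) ==> (k == ek.2)) s.
have -> s' : product_prob (fun w => all (fun ek => w ek.1 == ek.2) s') =
    \prod_e \sum_(k | Q s' e k) p k.
  rewrite bigA_distr_big_dep /product_prob; apply: eq_bigl => w.
  apply/allP/familyP => [h e|h ek eks].
    by apply/allP => ek /h /eqP <-; apply/implyP => /eqP->.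
  by have /allP/(_ _ eks) := h ek.1; rewrite eqxx.
elim: s => [_|[e k] s ih /= /andP[es us]].
  by rewrite big_nil big1.
rewrite big_cons/= -ih// (bigD1 e)//= [in RHS](bigD1 e)//=.
have -> : \sum_(k' | Q ((e, k) :: s) e k') p k' = p k.
  rewrite (big_pred1 k)// => k'; rewrite /Q /= eqxx/=.
  case: eqP => //= _; apply/allP => -[e' k''] /= eks; apply/implyP => /eqP ee.
  by case/mapP: es; exists (e', k'').
have -> : \sum_(k' | Q s e k') p k' = 1.
  rewrite -p1; apply: eq_bigl => k'; apply/allP => -[e' k''] /= eks.
  by apply/implyP => /eqP ee; case/mapP: es; exists (e', k'').
rewrite mul1r; congr (_ * _); apply: eq_bigr => e' e'e; apply: eq_bigl => k'.
by rewrite /Q /= eq_sym (negPf e'e).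
Qed.

Definition agree S w w' := [forall e in S, w' e == w e].

(** The factors at coordinates in [S] are omitted rather than divided out, so conditioning makes
    sense even on values of probability zero. *)
Definition cond_prob S w A : R :=
  \sum_(w' | A w' && agree S w w') \prod_(e | e \notin S) p (w' e).

Lemma cond_prob_set0 w A : cond_prob finset.set0 w A = product_prob A.
Proof.
apply: eq_big => [w'|w' _]; last by apply: eq_bigl => e; rewrite inE.
rewrite (_ : agree _ _ _) ?andbT//; apply/forall_inP => e.
by rewrite inE.
Qed.

Lemma cond_prob_le1 S w A : cond_prob S w A <= 1.
Proof.
pose Q e : pred K := fun k => (e \in S) ==> (k == w e).
have <- : \prod_e \sum_(k | Q e k) (if e \in S then 1 else p k) = 1 :> R.
  apply: big1 => e _; case: (boolP (e \in S)) => eS.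
    by rewrite (eq_bigl (pred1 (w e))) ?big_pred1_eq// => k; rewrite /Q eS.
  by rewrite -[RHS]p1; apply: eq_bigl => k; rewrite /Q (negPf eS).
rewrite bigA_distr_big_dep /cond_prob big_mkcond [leRHS]big_mkcond/=.
apply: ler_sum => w' _.
have -> : (w' \in family Q) = agree S w w'.
  apply/familyP/forall_inP => [h e eS|h e].
    by have := h e; rewrite unfold_in /Q eS.
  by rewrite unfold_in /Q; apply/implyP; exact: h.
rewrite andbC; case: (agree S w w') => //=.
have -> : \prod_e (if e \in S then 1 else p (w' e)) = \prod_(e | e \notin S) p (w' e).
  by rewrite [RHS]big_mkcond; apply: eq_bigr => e _; case: (e \in S).
by case: ifP => // _; apply: prodr_ge0.
Qed.

Definition reveal w e k : {ffun E -> K} := [ffun e' => if e' == e then k else w e'].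

Lemma agree_reveal S w e k w' : e \notin S ->
  agree (e |: S) (reveal w e k) w' = agree S w w' && (w' e == k).
Proof.
move=> eS; apply/forall_inP/andP => [h|[/forall_inP h /eqP ek] e' /setU1P[->|e'S]].
- split; last by have := h e; rewrite !inE !ffunE !eqxx => /(_ isT).
  apply/forall_inP => e' e'S; have := h e'; rewrite !inE e'S orbT => /(_ isT).
  by rewrite ffunE ifN//; apply: contraNneq eS => <-.
- by rewrite ffunE eqxx ek.
- by rewrite ffunE ifN ?h//; apply: contraNneq eS => <-.
Qed.

(** The law of total probability, in the form in which a search exposes one edge at a time. *)
Lemma cond_prob_reveal S w A e : e \notin S ->
  cond_prob S w A = \sum_k p k * cond_prob (e |: S) (reveal w e k) A.
Proof.
move=> eS; rewrite /cond_prob (partition_big (fun w' : {ffun E -> K} => w' e) predT)//=.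
apply: eq_bigr => k _; rewrite big_distrr/=.
apply: eq_big => [w'|w' /andP[_ /eqP <-]]; first by rewrite agree_reveal// andbA.
rewrite (bigD1 e)//=; congr (_ * _); apply: eq_bigl => e'.
by rewrite !inE negb_or andbC.
Qed.

End ProductSpace.

(** * Labelled paths and low segments *)

Section Edges.
Variable n : nat.
Implicit Types (i j v : 'I_n) (e : edge n).

Definition edge_between i j : option (edge n) :=
  if insub (i, j) is Some e then Some e else insub (j, i).

Lemma edge_between_neq i j : i != j -> exists e, edge_between i j = Some e.
Proof.
rewrite neq_ltn /edge_between => /orP[ij|ji]; first by rewrite insubT; eexists.
case: insubP => [e _ _|_]; first by eexists.
by rewrite insubT; eexists.
Qed.

Lemma edge_betweenP i j e : edge_between i j = Some e ->
  (i, j) = val e \/ (j, i) = val e.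
Proof.
rewrite /edge_between; case: insubP => [u _ <- [->]|_]; first by left.
by case: insubP => // u _ <- [->]; right.
Qed.

Lemma edge_betweenC i j : edge_between i j = edge_between j i.
Proof.
rewrite /edge_between; case: insubP => [u /= ij uE|ij]; case: insubP => [u' /= ji u'E|ji] //.
by move: ij; rewrite ltnNge (ltnW ji).
Qed.

Lemma edge_between_inj i j i' j' e :
  edge_between i j = Some e -> edge_between i' j' = Some e ->
  (i = i' /\ j = j') \/ (i = j' /\ j = i').
Proof.
move=> /edge_betweenP h1 /edge_betweenP h2.
by case: h1 => h1; case: h2; rewrite -h1 => -[-> ->]; [left|right|right|left].
Qed.

Variable K : finType.
Implicit Types (s : seq ('I_n * K)) (w : {ffun edge n -> K}).

(** An entry of [s] is the next vertex with the label of the edge leading to it. The [None] branch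
    is met only when two consecutive vertices coincide. *)
Fixpoint labelled_edges v s : seq (edge n * K) :=
  if s is (y, k) :: s' then
    if edge_between v y is Some e then (e, k) :: labelled_edges y s'
    else labelled_edges y s'
  else [::].

Lemma labelled_edges_cat v s1 s2 : labelled_edges v (s1 ++ s2) =
  labelled_edges v s1 ++ labelled_edges (last v (map fst s1)) s2.
Proof.
by elim: s1 v => [|[y k] s1 ih] v //=; rewrite ih; case: edge_between.
Qed.

Lemma labelled_edges_endpoint v s ek i : ek \in labelled_edges v s ->
  (i == (val ek.1).1) || (i == (val ek.1).2) -> i \in v :: map fst s.
Proof.
elim: s v => [|[y k] s ih] v //=.
case E: edge_between => [e|]; last by move=> /ih h /h hi; rewrite inE hi orbT.
rewrite inE => /predU1P[->/=|/ih h /h hi]; last by rewrite inE hi orbT.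
by case: (edge_betweenP E) => <- /= /orP[] /eqP ->; rewrite !inE eqxx ?orbT.
Qed.

Lemma labelled_edges_uniq v s : uniq (v :: map fst s) ->
  uniq (map fst (labelled_edges v s)).
Proof.
elim: s v => [|[y k] s ih] v //= /andP[vs ys].
case E: edge_between => [e|]; last exact: ih.
rewrite /= ih// andbT; apply/mapP => -[ek eks /= ee].
move: vs => /negP; apply; rewrite -[_ \in _]/(v \in y :: map fst s).
apply: (labelled_edges_endpoint (i := v) eks); rewrite -ee.
by case: (edge_betweenP E) => <- /=; rewrite eqxx ?orbT.
Qed.

Lemma labelled_edges_labels v s : uniq (v :: map fst s) ->
  map snd (labelled_edges v s) = map snd s.
Proof.
elim: s v => [|[y k] s ih] v //= /andP[vs ys].
have [|e ->] := @edge_between_neq v y; last by rewrite /= ih.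
by apply: contraNneq vs => ->; rewrite inE eqxx.
Qed.

End Edges.

(** * Cutting a path into segments *)

Section Segments.
Variables (n l H J : nat).
Local Notation lpath := (seq ('I_n * 'I_J.+1)).

Definition label_sum (s : lpath) : nat := \sum_(vk <- s) vk.2.

(* Labelled paths that, started at height [x], leave the tube [(l, l + H]]
   through its bottom within [L] steps or stay in it for [L] steps. *)
Fixpoint low_segments L x : seq lpath :=
  if L is L'.+1 then
    flatten [seq (if (x - l + vk.2 <= l)%N then [:: [:: vk]]
                  else if (x - l + vk.2 <= l + H)%N then
                    [seq vk :: s | s <- low_segments L' (x - l + vk.2)%N]
                  else [::]) | vk : 'I_n * 'I_J.+1]
  else [:: [::]].

Lemma low_segments_cons L x vk (s : lpath) : (vk :: s \in low_segments L.+1 x) =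
  if (x - l + vk.2 <= l)%N then s == [::]
  else (x - l + vk.2 <= l + H)%N && (s \in low_segments L (x - l + vk.2)%N).
Proof.
apply/flatten_mapP/idP => [[vk' _]|h].
  case: ifP => [h|h]; first by rewrite inE => /eqP[-> ->]; rewrite h.
  case: ifP => // h' /mapP[s' s's [-> ->]]; by rewrite h h'.
exists vk; first by rewrite mem_enum.
move: h; case: ifP => [_ /eqP->|_ /andP[-> h]]; first by rewrite inE.
exact: map_f.
Qed.

Lemma low_segments_nil L x : ([::] : lpath) \notin low_segments L.+1 x.
Proof.
apply/negP => /flatten_mapP[vk _]; case: ifP => // _.
by case: ifP => // _ /mapP[].
Qed.

Lemma label_sum_cat s1 s2 : label_sum (s1 ++ s2) = (label_sum s1 + label_sum s2)%N.
Proof. by rewrite /label_sum big_cat. Qed.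

Lemma split_segment L x (s : lpath) : (l < x <= l + H)%N ->
  [\/ exists s1 s2, [/\ s = s1 ++ s2, s1 \in low_segments L x, (size s1 <= L)%N
        & (l * size s1 < x + label_sum s1)%N],
      exists s1 s2, [/\ s = s1 ++ s2, (0 < size s1 <= L)%N
        & (l + H + l * size s1 < x + label_sum s1)%N]
    | (size s < L)%N /\ (l * size s < x + label_sum s)%N].
Proof.
elim: L x s => [|L ih] x s /andP[lx xH].
  constructor 1; exists [::], s; split => //.
  by rewrite muln0; lia.
case: s => [|vk s].
  by constructor 3; split => //; rewrite muln0; lia.
have sumE s' : label_sum (vk :: s') = (vk.2 + label_sum s')%N.
  by rewrite /label_sum big_cons.
have [yl|ly] := leqP (x - l + vk.2)%N l.
  constructor 1; exists [:: vk], s; split => //.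
    by rewrite low_segments_cons yl.
  by rewrite sumE /label_sum big_nil muln1; lia.
have [yH|Hy] := leqP (x - l + vk.2)%N (l + H)%N; last first.
  constructor 2; exists [:: vk], s; split => //.
  by rewrite sumE /label_sum big_nil muln1; lia.
have /(ih _ s) : (l < x - l + vk.2 <= l + H)%N by rewrite ly.
case=> [[s1 [s2 [-> s1L s1s h]]]|[s1 [s2 [-> s1L h]]]|[sL h]].
- constructor 1; exists (vk :: s1), s2; split => //.
    by rewrite low_segments_cons leqNgt ly/= yH.
  by rewrite sumE /= mulnS; lia.
- constructor 2; exists (vk :: s1), s2; split => //; first by case/andP: s1L.
  by rewrite sumE /= mulnS; lia.
- by constructor 3; split => //; rewrite sumE /= mulnS; lia.
Qed.

(** Greedy cutting from the left, restarting at height [x] after each piece: [PL] collects the low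
    segments with their starting vertices, [b] counts the exits through the top. The two
    inequalities add up those of the pieces, [+ 1] standing for an unfinished last piece. *)
Lemma decompose_path L x v (s : lpath) : (0 < L)%N -> (l < x <= l + H)%N ->
  uniq (v :: map fst s) ->
  exists (PL : seq ('I_n * lpath)) (b : nat),
  [/\ forall q, q \in PL -> q.2 \in low_segments L x /\ uniq (q.1 :: map fst q.2),
      subseq (flatten [seq labelled_edges q.1 q.2 | q <- PL]) (labelled_edges v s),
      subseq (map fst PL) (v :: map fst s),
      (size s <= (size PL + b + 1) * L)%N
    & (l * size s + b * (l + H - x) <= label_sum s + (size PL + 1) * x)%N].
Proof.
move=> L0 xH; have [m] := ubnP (size s); elim: m v s => // m ih v s sm us.
have [h|h|[sL h]] := split_segment L s xH; last first.
- exists [::], 0; split => //=; first exact: sub0seq.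
    by rewrite add0n mul1n ltnW.
  by rewrite mul0n addn0 mul1n addnC ltnW// addnC.
- case: h => s1 [s2 [sE /andP[s10 s1L] h]].
  have [||PL [b [hPL hsub hst hsz hsum]]] := ih (last v (map fst s1)) s2.
  + by move: sm; rewrite sE size_cat; lia.
  + move: us; rewrite sE map_cat -cat_cons (lastI v) cat_rcons cat_uniq => /and3P[_ _].
    by [].
  exists PL, b.+1; split => //.
  + rewrite sE labelled_edges_cat; apply: subseq_trans hsub _.
    exact: suffix_subseq.
  + apply: (subseq_trans hst); rewrite sE map_cat -cat_cons (lastI v) cat_rcons.
    exact: suffix_subseq.
  + by rewrite sE size_cat; nia.
  + rewrite sE size_cat label_sum_cat; nia.
- case: h => s1 [s2 [sE s1S s1L h]].
  have s10 : (0 < size s1)%N.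
    case: s1 s1S {sE s1L h} => //; rewrite -(prednK L0) => h.
    by have := low_segments_nil L.-1 x; rewrite h.
  have u2 : uniq (last v (map fst s1) :: map fst s2).
    by move: us; rewrite sE map_cat -cat_cons (lastI v) cat_rcons cat_uniq => /and3P[].
  have [||PL [b [hPL hsub hst hsz hsum]]] := ih (last v (map fst s1)) s2 => //.
    by move: sm; rewrite sE size_cat; lia.
  exists ((v, s1) :: PL), b; split => //.
  + move=> q; rewrite inE => /predU1P[->/=|/hPL//]; split => //.
    by move: us; rewrite sE map_cat -cat_cons cat_uniq => /and3P[].
  + by rewrite sE labelled_edges_cat /=; apply: cat_subseq.
  + suff : subseq (map fst PL) (map fst s) by rewrite /= eqxx.
    apply: (subseq_trans hst); rewrite sE map_cat.
    case: s1 s10 {s1S s1L h sE u2 hsub ih hst} => // vk s1 _.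
    have -> : last v (map fst (vk :: s1)) = last vk.1 (map fst s1) by [].
    by rewrite [map fst (vk :: s1)]/= (lastI vk.1) cat_rcons; exact: suffix_subseq.
  + by rewrite sE size_cat /=; nia.
  + rewrite sE size_cat label_sum_cat /=; nia.
Qed.

End Segments.

(** * Expected number of low segments from a vertex *)

Section LowSegmentWeight.
Context {R : realType}.
Variables (n l H J N : nat) (p : 'I_J.+1 -> R).
Hypotheses (p0 : forall k, 0 <= p k)
  (pN : forall k : 'I_J.+1, (k < J)%N -> n%:R * p k <= N%:R^-1).
Hypothesis HJ : (l + H <= J)%N.

(** An upper bound for the expected number of low segments from a given vertex: the vertices range
    over all sequences, repetitions included. *)
Definition low_weight L x : R :=
  \sum_(s <- low_segments n l H J L x) \prod_(vk <- s) p vk.2.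

Lemma low_weight_ge0 L x : 0 <= low_weight L x.
Proof. by apply: sumr_ge0 => s _; apply: prodr_ge0. Qed.

Lemma low_weightS L x : low_weight L.+1 x =
  n%:R * \sum_(k < J.+1) p k *
    (if (x - l + k <= l)%N then 1
     else if (x - l + k <= l + H)%N then low_weight L (x - l + k)%N else 0).
Proof.
rewrite /low_weight /= big_flatten/= big_map big_enum/=.
transitivity (\sum_(vk : 'I_n * 'I_J.+1) p vk.2 *
    (if (x - l + vk.2 <= l)%N then 1
     else if (x - l + vk.2 <= l + H)%N then low_weight L (x - l + vk.2)%N else 0)).
  apply: eq_bigr => vk _; case: ifP => _.
    by rewrite big_seq1 big_seq1 mulr1.
  case: ifP => _; last by rewrite big_nil mulr0.
  by rewrite big_map mulr_sumr; apply: eq_bigr => s _; rewrite big_cons.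
rewrite -(pair_bigA _ (fun (i : 'I_n) (k : 'I_J.+1) => p k *
    (if (x - l + k <= l)%N then 1
     else if (x - l + k <= l + H)%N then low_weight L (x - l + k)%N else 0)))/=.
by rewrite sumr_const card_ord mulr_natl.
Qed.

(** Comparison with a supersolution, by induction on [L]. Only labels below [J], to which [pN]
    applies, contribute: since [l + H <= J], the cap label overshoots the tube. *)
Lemma low_weight_le (g : nat -> nat -> R) :
  (forall x, (l < x <= l + H)%N -> 1 <= g 0 x) ->
  (forall L x, (l < x <= l + H)%N -> 0 <= g L x) ->
  (forall L x, (l < x <= l + H)%N ->
    N%:R^-1 * \sum_(k < J) (if (x - l + k <= l)%N then 1
      else if (x - l + k <= l + H)%N then g L (x - l + k)%N else 0) <= g L.+1 x) ->
  forall L x, (l < x <= l + H)%N -> low_weight L x <= g L x.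
Proof.
move=> g1 g0 gS; elim=> [|L ih] x xH.
  by rewrite /low_weight /= big_seq1 big_nil g1.
apply: le_trans (gS L x xH); rewrite low_weightS big_ord_recr/=.
rewrite ifF; last by apply/negbTE; case/andP: xH; lia.
rewrite ifF; last by apply/negbTE; case/andP: xH; lia.
rewrite mulr0 addr0 !mulr_sumr; apply: ler_sum => k _.
rewrite mulrA; case: ifPn => ly.
  by rewrite !mulr1; exact: (@pN (widen_ord (leqnSn J) k) (ltn_ord k)).
case: ifPn => yH; last by rewrite !mulr0.
apply: ler_pM => //; [by rewrite mulr_ge0|exact: low_weight_ge0|
  exact: (@pN (widen_ord (leqnSn J) k) (ltn_ord k))|].
by apply: ih; rewrite yH andbT ltnNge.
Qed.

(** A sum of two supersolutions. The geometric one is at least 1 at heights up to [l] and pays for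
    exits through the bottom; its ratio [r = l / (l + 1)] minimises [1 / (r ^ l (1 - r))], whose
    value is at most [e (l + 1)]. The sine one, normalised by its lower bound [umin], pays for walks
    still in the tube after [L] steps. *)
Lemma low_weight_bound (th A umin : R) L x : (0 < l)%N -> (0 < N)%N -> 0 < th ->
  l.+1%:R * th < pi -> (H + l.*2.+1)%:R * th = pi ->
  1 <= A -> expR 1 * l.+1%:R / N%:R <= A -> 0 < umin ->
  (forall y, (l < y <= l + H)%N -> umin <= tilt l th ^+ y * sin (y%:R * th)) ->
  (l < x <= l + H)%N ->
  low_weight L x <= A ^+ L * (l%:R / l.+1%:R) ^+ (x - l) +
    (growth l th / N%:R) ^+ L * (tilt l th ^+ x * sin (x%:R * th) / umin).
Proof.
move=> l0 N0 th0 thpi Hpi A1 AN um0 umle.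
set r := l%:R / l.+1%:R; set rho := growth l th / N%:R.
pose u y := tilt l th ^+ y * sin (y%:R * th).
have rho0 : 0 <= rho by rewrite divr_ge0// (ltW (growth_gt0 l0 th0 thpi)).
have r0 : 0 < r by rewrite divr_gt0 ?ltr0n.
have r1 : 1 - r = l.+1%:R^-1.
  by rewrite /r -natr1; field; rewrite natr1 pnatr_eq0.
have rl1 : r < 1 by rewrite -subr_gt0 r1 invr_gt0 ltr0n.
have A0 : 0 < A by apply: lt_le_trans A1.
have u0 y : (l < y <= l + H)%N -> 0 <= u y.
  by move=> /umle; apply: le_trans; exact: ltW.
have rl : (r ^+ l)^-1 <= expR 1.
  rewrite -exprVn invf_div.
  have -> : l.+1%:R / l%:R = 1 + l%:R^-1 :> R.
    by rewrite -natr1; field; rewrite pnatr_eq0 -lt0n.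
  have -> : expR 1 = expR (l%:R^-1) ^+ l :> R.
    by rewrite -expRM_natr mulVf// pnatr_eq0 -lt0n.
  by rewrite lerXn2r ?nnegrE ?expR_ge0 ?addr_ge0 ?invr_ge0// expR_ge1Dx.
have geom y : N%:R^-1 * \sum_(k < J) (r ^+ (y + k) / r ^+ l) <= A * r ^+ y.
  have -> : \sum_(k < J) (r ^+ (y + k) / r ^+ l) = r ^+ y / r ^+ l * \sum_(k < J) r ^+ k.
    by rewrite mulr_sumr; apply: eq_bigr => k _; rewrite exprD mulrAC.
  have h : \sum_(k < J) r ^+ k <= l.+1%:R.
    have E : 1 - r ^+ J = (1 - r) * \sum_(k < J) r ^+ k.
      by rewrite -opprB subrX1 -mulNr opprB.
    have -> : \sum_(k < J) r ^+ k = l.+1%:R * (1 - r ^+ J).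
      by rewrite E r1 mulrA mulfV ?mul1r.
    by rewrite ler_piMr// gerBl exprn_ge0// ltW.
  apply: (@le_trans _ _ (N%:R^-1 * (r ^+ y * expR 1 * l.+1%:R))).
    rewrite ler_wpM2l ?invr_ge0//; apply: ler_pM => //.
    - by rewrite divr_ge0// exprn_ge0// ltW.
    - by apply: sumr_ge0 => k _; rewrite exprn_ge0// ltW.
    - by rewrite ler_wpM2l// exprn_ge0// ltW.
  rewrite [leLHS](_ : _ = expR 1 * l.+1%:R / N%:R * r ^+ y); last by ring.
  by rewrite ler_wpM2r// exprn_ge0// ltW.
apply: (@low_weight_le (fun L x => A ^+ L * r ^+ (x - l) + rho ^+ L * (u x / umin))).
- move=> y yH; rewrite !expr0 !mul1r.
  apply: (@le_trans _ _ (u y / umin)); first by rewrite ler_pdivlMr// mul1r umle.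
  by rewrite lerDr exprn_ge0// ltW.
- move=> L' y yH; rewrite addr_ge0// mulr_ge0 ?exprn_ge0 ?(ltW A0) ?(ltW r0)//.
  by rewrite divr_ge0 ?u0// ltW.
- move=> L' y /[dup] yH /andP[ly yH'].
  apply: (@le_trans _ _ (A ^+ L' * (N%:R^-1 * \sum_(k < J) (r ^+ (y - l + k) / r ^+ l))
    + rho ^+ L' / umin * (N%:R^-1 * \sum_(k < J | (l < y - l + k <= l + H)%N) u (y - l + k)%N))); last first.
    rewrite (exprS A) -(mulrA A) (exprS rho) -(mulrA rho); apply: lerD.
      by rewrite [leRHS]mulrCA ler_wpM2l ?exprn_ge0 ?(ltW A0)//.
    rewrite [leRHS](_ : _ = rho ^+ L' / umin * (rho * u y)); last by ring.
    rewrite ler_wpM2l ?divr_ge0 ?exprn_ge0 ?(ltW um0)//.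
    rewrite /rho mulrC mulrAC ler_wpM2r ?invr_ge0//.
    exact: kernel_tube_le.
  rewrite [leRHS]addrC mulrCA [X in _ <= _ + X]mulrCA -mulrDr ler_wpM2l ?invr_ge0//.
  rewrite !mulr_sumr [X in _ <= X + _]big_mkcond -big_split/=; apply: ler_sum => k _.
  case: ifPn => yl.
    rewrite ltnNge yl/= add0r.
    have -> : r ^+ (y - l + k) / r ^+ l = (r ^+ (l - (y - l + k)))^-1.
      have -> : r ^+ l = r ^+ (y - l + k) * r ^+ (l - (y - l + k)).
        by rewrite -exprD subnKC.
      by field; rewrite !expf_neq0// gt_eqF.
    apply: (@le_trans _ _ (1 * 1)); first by rewrite mulr1.
    apply: ler_pM => //; first exact: exprn_ege1.
    by rewrite -exprVn exprn_ege1// invf_ge1// ltW.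
  rewrite ltnNge yl/=; case: ifP => _; last first.
    by rewrite add0r mulr_ge0 ?divr_ge0 ?exprn_ge0// ltW.
  rewrite addrC lerD//; last by rewrite mulrA mulrAC.
  rewrite ler_wpM2l ?exprn_ge0 ?(ltW A0)//.
  rewrite ler_pdivlMr ?exprn_gt0// -exprD subnK//.
  by rewrite ltnW// ltnNge.
Qed.

End LowSegmentWeight.

(** * Union bound over families of low segments *)

Section ManySegments.
Context {R : realType}.
Variables (n l H J : nat) (p : 'I_J.+1 -> R).
Hypotheses (p0 : forall k, 0 <= p k) (p1 : \sum_k p k = 1).
Local Notation lpath := (seq ('I_n * 'I_J.+1)).
Implicit Types (w : {ffun edge n -> 'I_J.+1}).

Definition follows w (es : seq (edge n * 'I_J.+1)) := all (fun ek => w ek.1 == ek.2) es.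

(* A family of low segments is encoded by its (partial) choice function
   [vertex -> segment], index 0 standing for "no segment starts here"; the
   factor [e] per segment turns the number of segments into [exp (- M)]. *)
Lemma product_prob_low_segments L x M (A : pred {ffun edge n -> 'I_J.+1}) :
  (0 < L)%N ->
  (forall w, A w -> exists PL : seq ('I_n * lpath),
     [/\ forall q, q \in PL -> q.2 \in low_segments n l H J L x /\ uniq (q.1 :: map fst q.2),
         uniq (map fst (flatten [seq labelled_edges q.1 q.2 | q <- PL])),
         uniq (map fst PL),
         follows w (flatten [seq labelled_edges q.1 q.2 | q <- PL])
       & (M <= size PL)%N]) ->
  product_prob p A <= expR (n%:R * (expR 1 * low_weight n l H p L x) - M%:R).
Proof.
move=> L0 hA; pose S := low_segments n l H J L x.
pose seg (i : 'I_(size S).+1) : lpath := nth [::] ([::] :: S) i.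
pose es (g : {ffun 'I_n -> 'I_(size S).+1}) :=
  flatten [seq labelled_edges v (seg (g v)) | v <- enum 'I_n].
pose ok (g : {ffun 'I_n -> 'I_(size S).+1}) :=
  [&& uniq (map fst (es g)),
      [forall v, map snd (labelled_edges v (seg (g v))) == map snd (seg (g v))]
    & (M <= #|[pred v | g v != ord0]|)%N].
pose c (i : 'I_(size S).+1) : R := if i == ord0 then 1 else expR 1.
have c0 i : 0 < c i by rewrite /c; case: ifP => _; rewrite ?expR_gt0.
have wS i : 0 <= \prod_(vk <- seg i) p vk.2 by apply: prodr_ge0.
apply: (@le_trans _ _ (\sum_g product_prob p (fun w => ok g && follows w (es g)))).
  apply: product_prob_union => // w /hA[PL [hPL ue us fw MPL]].
  pose gs v : lpath := nth [::] (map snd PL) (index v (map fst PL)).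
  have gsP q : q \in PL -> gs q.1 = q.2.
    move=> qPL; have /nthP -/(_ q)[i iPL <-] := qPL; rewrite /gs.
    by rewrite -(nth_map q q.1)// index_uniq ?size_map// (nth_map q).
  have gs0 v : v \notin map fst PL -> gs v = [::].
    by move=> /memNindex h; rewrite /gs h nth_default// !size_map.
  have gsS v : v \in map fst PL -> gs v \in S.
    by case/mapP => q qPL ->; rewrite gsP//; case: (hPL _ qPL).
  pose g : {ffun 'I_n -> 'I_(size S).+1} :=
    [ffun v => if v \in map fst PL then inord (index (gs v) S).+1 else ord0].
  have idx v : v \in map fst PL -> nat_of_ord (g v) = (index (gs v) S).+1.
    by move=> vPL; rewrite ffunE vPL inordK// ltnS index_mem gsS.
  have segg v : seg (g v) = gs v.
    rewrite /seg; have [vPL|vPL] := boolP (v \in map fst PL).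
      by rewrite idx//= nth_index// gsS.
    by rewrite ffunE (negPf vPL)/= gs0.
  (* [es g] lists the segments by starting vertex, [PL] in the order of the family; the edge lists
     agree up to permutation. *)
  have pes : perm_eq (es g) (flatten [seq labelled_edges q.1 q.2 | q <- PL]).
    have -> : [seq labelled_edges q.1 q.2 | q <- PL] =
        [seq labelled_edges v (gs v) | v <- map fst PL].
      by rewrite -map_comp; apply/eq_in_map => q /gsP /= ->.
    have -> : es g = flatten [seq labelled_edges v (gs v) |
        v <- enum 'I_n & v \in map fst PL].
      rewrite /es; elim: (enum 'I_n) => //= v vs ->; rewrite segg.
      by case: ifPn => //= vPL; rewrite gs0.
    apply/perm_flatten/perm_map/uniq_perm => [||v]; [|by []|].
      by apply/filter_uniq/enum_uniq.
    by rewrite mem_filter mem_enum andbT.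
  exists g; apply/andP; split; last by rewrite /follows (perm_all _ pes).
  apply/and3P; split.
  - by rewrite (perm_uniq (perm_map fst pes)).
  - apply/forallP => v; rewrite segg; apply/eqP.
    have [/mapP[q qPL ->]|vPL] := boolP (v \in map fst PL); last by rewrite gs0.
    by rewrite gsP//; apply: labelled_edges_labels; case: (hPL _ qPL).
  - apply: (leq_trans MPL); rewrite -(size_map fst) -(card_uniqP us).
    apply: subset_leq_card; apply/fintype.subsetP => v vPL; rewrite inE.
    by rewrite -(inj_eq val_inj)/= idx.
have bound g : product_prob p (fun w => ok g && follows w (es g)) <=
    expR (- M%:R) * \prod_v (c (g v) * \prod_(vk <- seg (g v)) p vk.2).
  have [okg|_] := boolP (ok g); last first.
    rewrite [leLHS]big_pred0//; apply: mulr_ge0; first exact: expR_ge0.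
    by apply: prodr_ge0 => v _; rewrite mulr_ge0// ltW.
  case/and3P: okg => ue /forallP lab Mg.
  rewrite [leLHS](product_prob_cylinder p1 ue) /es big_flatten big_map big_enum/=.
  rewrite big_split/= mulrA.
  have -> : \prod_v \prod_(ek <- labelled_edges v (seg (g v))) p ek.2 =
      \prod_v \prod_(vk <- seg (g v)) p vk.2.
    apply: eq_bigr => v _; rewrite -(big_map snd xpredT p) -[RHS](big_map snd xpredT p).
    by rewrite (eqP (lab v)).
  rewrite -[leLHS]mul1r ler_wpM2r//; first by apply: prodr_ge0.
  have -> : \prod_v c (g v) = expR (#|[pred v | g v != ord0]|%:R).
    rewrite -[X in expR X]mulr1 expRM_natl -prodr_const [RHS]big_mkcond/=.
    by apply: eq_bigr => v _; rewrite inE /c; case: (g v == ord0).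
  rewrite -expRD -[leLHS]expR0 ler_expR addrC subr_ge0 ler_nat//.
apply: (le_trans (ler_sum _ (fun g _ => bound g))).
(* The sum over choice functions factors over the vertices into [(1 + e * low_weight) ^ n], at most
   [exp (n * e * low_weight)]. *)
rewrite -mulr_sumr -(bigA_distr_bigA (fun _ i => c i * \prod_(vk <- seg i) p vk.2)).
rewrite prodr_const card_ord.
have -> : \sum_(i < (size S).+1) c i * \prod_(vk <- seg i) p vk.2 =
    1 + expR 1 * low_weight n l H p L x.
  rewrite big_ord_recl /= /c eqxx /seg /= big_nil mulr1; congr (_ + _).
  rewrite /low_weight -/S mulr_sumr (big_nth [::]) big_mkord.
  by apply: eq_bigr => i _.
rewrite expRD mulrC ler_wpM2r ?expR_ge0//.
have W0 : 0 <= low_weight n l H p L x by exact: low_weight_ge0.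
rewrite expRM_natl lerXn2r ?nnegrE ?expR_ge0 ?expR_ge1Dx//.
by rewrite addr_ge0// mulr_ge0// expR_ge0.
Qed.

(* [3 M L < size s] forces at least [M] low segments: a segment leaving the
   tube through its top climbs as much as a low one can descend. *)
Lemma product_prob_long_path L D M (A : pred {ffun edge n -> 'I_J.+1}) :
  (0 < L)%N -> (0 < l <= D)%N -> H = D.*2 ->
  (forall w, A w -> exists v (s : lpath),
     [/\ uniq (v :: map fst s), follows w (labelled_edges v s),
         (label_sum s <= l * size s)%N & (3 * M * L < size s)%N]) ->
  product_prob p A <= expR (n%:R * (expR 1 * low_weight n l H p L (l + D)) - M%:R).
Proof.
move=> L0 /andP[l0 lD] HD hA; apply: product_prob_low_segments => // w /hA[v [s [us fw ls Ms]]].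
have xH : (l < l + D <= l + H)%N by rewrite HD; lia.
have [PL [b [hPL hsub hst hsz hsum]]] := decompose_path L0 xH us.
exists PL; split => //.
- by apply: subseq_uniq (map_subseq fst hsub) _; exact: labelled_edges_uniq.
- exact: subseq_uniq hst us.
- apply/allP => ek /(mem_subseq hsub); exact: (allP fw).
- rewrite HD in hsum.
  (* Starting from the middle, a top exit climbs [D], while any other piece descends at most
     [l + D <= 2 D]. *)
  have b2 : (b <= 2 * (size PL + 1))%N.
    have -> : (2 * (size PL + 1) = (size PL + 1) * 2)%N by lia.
    rewrite -(@leq_pmul2r D); last by lia.
    have -> : ((size PL + 1) * 2 * D = (size PL + 1) * (D + D))%N by lia.
    apply: (@leq_trans ((size PL + 1) * (l + D))); last by rewrite leq_mul2l; lia.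
    move: hsum; have -> : (l + D.*2 - (l + D) = D)%N by lia.
    lia.
  have : (size PL + b + 1 <= 3 * (size PL + 1))%N by lia.
  rewrite -(leq_pmul2r L0) => h.
  have : (3 * M * L < 3 * (size PL + 1) * L)%N by lia.
  by rewrite ltn_pmul2r//; lia.
Qed.

End ManySegments.

(** * Depth-first search *)

Section DepthFirstSearch.
Context {R : realType}.
Variables (n l hi J : nat) (p : 'I_J.+1 -> R).
Hypotheses (p0 : forall k, 0 <= p k) (p1 : \sum_k p k = 1).
Local Notation Omega := {ffun edge n -> 'I_J.+1}.
Local Notation entry := ('I_n * (nat * nat))%type.
Implicit Types (w : Omega) (st : seq entry) (T : {set 'I_n}) (S : {set edge n}).

(* A stack entry [(v, (x, q))] is a vertex, its height in the tube and a bound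
   on the number of unvisited vertices to which its edge is already revealed. *)
Fixpoint chain w st : bool :=
  if st is a :: st' then
    if st' is b :: _ then
      (if edge_between b.1 a.1 is Some e then a.2.1 == (b.2.1 - l + w e)%N else false)
      && chain w st'
    else true
  else true.

Definition in_tube x := (l < x < hi)%N.

Variables (u : nat -> R) (umax s eps n' : R) (m0 : nat) (bad : pred Omega).
Hypotheses (s0 : 0 <= s) (eps0 : 0 <= eps) (n'0 : 0 < n') (umax0 : 0 <= umax)
  (epsu : forall x, in_tube x -> eps <= u x)
  (uumax : forall x, in_tube x -> u x <= umax)
  (step : forall x, in_tube x -> expR (s * u x / n') - 1 <=
     \sum_(k : 'I_J.+1 | in_tube (x - l + k)%N) p k * (1 - expR (- (s * (u (x - l + k)%N - eps)))))
  (badP : forall w st, uniq (map fst st) -> all (fun a => in_tube a.2.1) st ->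
     chain w st -> (m0 <= size st)%N -> ~~ bad w).
Variable root : nat.
Hypothesis root_tube : in_tube root.

Definition potential st : R := \sum_(a <- st) u a.2.1 * (1 - a.2.2%:R / n').

Definition revealed S v y := if edge_between v y is Some e then e \in S else true.

(** [T] holds the unvisited vertices, [S] the revealed edges, and [w0] their values. The counters
    are only upper bounds, since a vertex that leaves [T] is not deducted from them. *)
Definition search_inv T st S (w0 : Omega) :=
  [/\ forall i j e, i \in T -> j \in T -> edge_between i j = Some e -> e \notin S,
      forall a, a \in st -> (#|[pred y in T | revealed S a.1 y]| <= a.2.2)%N,
      uniq (map fst st), forall a, a \in st -> a.1 \notin T
    & all (fun a => in_tube a.2.1) st /\ forall w, agree S w0 w -> chain w st].

(** When the search stops, at least [n - n'] vertices have been charged [eps] each, while a stack of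
    fewer than [m0] entries has potential at most [m0 * umax]. The difference is the deviation that
    a bad outcome requires. *)
Definition budget : R := eps * (n%:R - n') - m0%:R * umax.

(** The exponential supermartingale, scaled to be at least 1 when the search stops with a short
    stack. *)
Let weight T st : R :=
  expR (- (s * (potential st - eps * (n%:R - #|T|%:R)))) * expR (- (s * budget)).

Lemma potential_cons a st :
  potential (a :: st) = u a.2.1 * (1 - a.2.2%:R / n') + potential st.
Proof. by rewrite /potential big_cons. Qed.

Lemma potential_le st : all (fun a => in_tube a.2.1) st ->
  potential st <= (size st)%:R * umax.
Proof.
elim: st => [_|a st ih /= /andP[ax /ih h]]; first by rewrite /potential big_nil mul0r.
rewrite potential_cons -add1n natrD mulrDl mul1r lerD//.
apply: le_trans (uumax ax); apply: ler_piMr; first exact: le_trans (epsu ax).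
by rewrite gerBl divr_ge0// ltW.
Qed.

(** The mean factor by which [weight] changes when an edge is revealed from height [x]: a push gains
    [u] of the new height and is charged [eps], a failure loses [u x / n']. *)
Lemma mean_step x : in_tube x ->
  \sum_k p k * (if in_tube (x - l + k)%N then expR (- (s * (u (x - l + k)%N - eps)))
                else expR (s * u x / n')) <= 1.
Proof.
move=> xt; set a := expR _; have a1 : 1 <= a.
  by rewrite /a -expR0 ler_expR divr_ge0 ?(ltW n'0)// mulr_ge0// (le_trans eps0)// epsu.
have -> : \sum_k p k * (if in_tube (x - l + k)%N then expR (- (s * (u (x - l + k)%N - eps)))
    else a) = a - \sum_(k : 'I_J.+1 | in_tube (x - l + k)%N) p k * (a - expR (- (s * (u (x - l + k)%N - eps)))).
  apply/eqP; rewrite -subr_eq0 opprB addrA -[X in _ - X]mul1r -p1 mulr_suml.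
  rewrite [X in _ + X - _]big_mkcond/= -big_split/= -sumrB; apply/eqP/big1 => k _.
  by case: ifP => _; ring.
rewrite lerBlDr -lerBlDl.
apply: le_trans (step xt) _; apply: ler_sum => k _.
by rewrite ler_wpM2l// lerD2r.
Qed.

(** A long stack excludes [bad], so the probability is 0; with a short one [weight] is at least
    1. *)
Lemma search_stop T st S w0 : search_inv T st S w0 -> #|T|%:R <= n' ->
  cond_prob p S w0 bad <= weight T st.
Proof.
move=> [_ _ us _ [tube ch]] Tn; have [big|small] := leqP m0 (size st).
  rewrite /cond_prob big_pred0 ?mulr_ge0 ?expR_ge0// => w.
  apply/negbTE; rewrite negb_and orbC -implybE; apply/implyP => /ch chw.
  exact: badP chw big.
apply: le_trans (cond_prob_le1 p0 p1 _ _ _) _.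
rewrite /weight -expRD -[leLHS]expR0 ler_expR -opprD -mulrDr oppr_ge0 mulr_ge0_le0//.
have h1 := potential_le tube.
have h2 : (size st)%:R * umax <= m0%:R * umax by rewrite ler_wpM2r// ler_nat ltnW.
have h3 : 0 <= eps * (n' - #|T|%:R) by rewrite mulr_ge0// subr_ge0.
rewrite /budget; lra.
Qed.

(** Nested induction on the number of unvisited vertices, the stack, and the number of unrevealed
    edges from its top to [T]. No move of the search (new root, pop, revealed edge) increases
    [weight] on average. *)
Lemma search_bound T st S w0 : search_inv T st S w0 ->
  cond_prob p S w0 bad <= weight T st.
Proof.
have [m] := ubnP #|T|; elim: m T st S w0 => // m ihT T st S w0 Tm.
elim: st S w0 => [|[v [x q]] st ihst] S w0.
  move=> inv; have [Tn|nT] := leP #|T|%:R n'; first exact: search_stop inv Tn.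
  have /card_gt0P[t tT] : (0 < #|T|)%N.
    by rewrite -(ltr_nat R); apply: lt_trans nT.
  have Tt : #|T| = #|T :\ t|.+1 by rewrite (cardsD1 t) tT.
  (* Empty stack: a new root is started, and [u root >= eps] pays for visiting it. *)
  apply: (@le_trans _ _ (weight (T :\ t) [:: (t, (root, 0%N))])); last first.
    rewrite /weight ler_pM2r ?expR_gt0// ler_expR lerN2 ler_wpM2l//.
    rewrite potential_cons /potential !big_nil/= mul0r Tt -natr1.
    by have := epsu root_tube; lra.
  case: inv => I1 I2 I3 I4 [I5 I6]; apply: ihT; first by rewrite -ltnS -Tt.
  split => //=.
  - by move=> i j e /setD1P[_ iT] /setD1P[_ jT]; exact: I1.
  - move=> a; rewrite inE => /eqP->/=; rewrite leqn0; apply/pred0P => y; apply/negP.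
    rewrite /= !inE => /andP[/andP[yt yT]].
    rewrite /revealed; case E: edge_between => [e|].
      by rewrite (negPf (I1 _ _ _ tT yT E)).
    by have [e] := edge_between_neq yt; rewrite edge_betweenC E.
  - by move=> a; rewrite inE => /eqP->/=; rewrite !inE eqxx.
  - by rewrite root_tube.
have [k] := ubnP #|[pred y in T | ~~ revealed S v y]|.
elim: k q S w0 => // k ihk q S w0 qk inv.
have [Tn|nT] := leP #|T|%:R n'; first exact: search_stop inv Tn.
case: (inv) => I1 I2 I3 I4 [/= /andP[xt I5] I6].
have vT : v \notin T by apply: (I4 (v, (x, q))); rewrite mem_head.
have := I3 => /= /andP[vst ust].
have [/existsP[y /andP[yT ry]]|/existsPn allr] :=
  boolP [exists y, (y \in T) && ~~ revealed S v y]; last first.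
  (* All edges from the top to [T] are revealed, so [q >= #|T| > n'] and the contribution of the top
     entry is nonpositive: popping it costs nothing. *)
  have Tq : (#|T| <= q)%N.
    have := I2 (v, (x, q)); rewrite mem_head => /(_ isT) /=; apply: leq_trans.
    apply: subset_leq_card; apply/fintype.subsetP => y yT; rewrite inE yT/=.
    by have := allr y; rewrite yT/= negbK.
  apply: (@le_trans _ _ (weight T st)); last first.
    rewrite /weight ler_pM2r ?expR_gt0// ler_expR lerN2 ler_wpM2l//.
    rewrite lerD2r potential_cons/= gerDr mulr_ge0_le0//.
      by apply: le_trans (epsu xt).
    rewrite subr_le0 ler_pdivlMr// mul1r; apply: (le_trans (ltW nT)).
    by rewrite ler_nat.
  apply: ihst; split => //.
  - by move=> a ast; apply: I2; rewrite inE ast orbT.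
  - by move=> a ast; apply: I4; rewrite inE ast orbT.
  - split => // w /I6 /=; case: (st) => [|b st'] //; by case/andP.
have [e ve] : exists e, edge_between v y = Some e.
  by apply: edge_between_neq; apply: contraNneq vT => ->.
have eS : e \notin S by move: ry; rewrite /revealed ve.
rewrite (cond_prob_reveal p w0 bad eS).
(* Revealing an edge from [v] into [T] changes no counter deeper in the stack. *)
have other a z : z \in T -> a \in st -> revealed (e |: S) a.1 z = revealed S a.1 z.
  move=> zT ast; rewrite /revealed; case E: edge_between => [e'|//].
  rewrite !inE; case: eqP => //= ee; exfalso; rewrite ee in E.
  have [[av _]|[ay _]] := edge_between_inj E ve.
    by move: vst; rewrite -av => /negP; apply; exact: map_f.
  have := I4 a; rewrite inE ast orbT => /(_ isT).
  by rewrite ay yT.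
pose val_k (i : 'I_J.+1) : R :=
  if in_tube (x - l + i)%N then expR (- (s * (u (x - l + i)%N - eps)))
  else expR (s * u x / n').
apply: (@le_trans _ _ (\sum_i p i * (val_k i * weight T ((v, (x, q)) :: st)))); last first.
  under eq_bigr do rewrite mulrA.
  rewrite -mulr_suml -[leRHS]mul1r ler_wpM2r ?mulr_ge0 ?expR_ge0//.
  exact: mean_step.
apply: ler_sum => i _; apply: ler_wpM2l => //; rewrite /val_k; case: ifPn => [it|_].
  have Ty : #|T| = #|T :\ y|.+1 by rewrite (cardsD1 y) yT.
  apply: (@le_trans _ _ (weight (T :\ y) ((y, ((x - l + i)%N, 0%N)) :: (v, (x, q)) :: st))).
    apply: ihT; first by rewrite -ltnS -Ty.
    split.
    - move=> i' j e' /setD1P[i'y i'T] /setD1P[jy jT] E; rewrite !inE negb_or (I1 _ _ _ i'T jT E) andbT.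
      apply/negP => /eqP ee; rewrite ee in E.
      have [[i'v _]|[i'y' _]] := edge_between_inj E ve.
        by move: vT; rewrite -i'v i'T.
      by rewrite i'y' eqxx in i'y.
    - move=> a; rewrite inE => /predU1P[->/=|ast].
        rewrite leqn0; apply/pred0P => z; apply/negP.
        rewrite /= !inE => /andP[/andP[zy zT]]; rewrite /revealed.
        case E: edge_between => [e'|]; last first.
          by have [e'] := edge_between_neq zy; rewrite edge_betweenC E.
        rewrite !inE (negPf (I1 _ _ _ yT zT E)) orbF => /eqP ee; rewrite ee in E.
        have [[yv _]|[_ zv]] := edge_between_inj E ve.
          by move: vT; rewrite -yv yT.
        by move: vT; rewrite -zv zT.
      apply: leq_trans (I2 a ast); apply: subset_leq_card; apply/fintype.subsetP => z.
      rewrite !inE => /andP[/andP[zy zT]] h; rewrite zT/=.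
      move: ast; rewrite inE => /predU1P[aE|ast]; last by rewrite -(other a).
      move: h; rewrite aE /= /revealed; case E: edge_between => [e'|//].
      rewrite !inE => /predU1P[ee|//]; rewrite ee in E.
      have [[_ zy']|[vy _]] := edge_between_inj E ve; first by rewrite zy' eqxx in zy.
      by move: vT; rewrite vy yT.
    - rewrite /= vst ust /= andbT inE negb_or; apply/andP; split.
        by apply: contraNneq vT => <-.
      apply/mapP => -[a ast ya]; have := I4 a; rewrite inE ast orbT => /(_ isT).
      by rewrite -ya yT.
    - move=> a; rewrite inE => /predU1P[->/=|/I4]; first by rewrite !inE eqxx.
      by apply: contra => /setD1P[].
    - split; first by rewrite /= it xt.
      move=> w; rewrite agree_reveal// => /andP[/I6 h /eqP we].
      by rewrite /= ve we eqxx.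
  rewrite /weight mulrA ler_pM2r ?expR_gt0// -expRD ler_expR.
  rewrite (potential_cons (y, _))/= mulr0n mul0r subr0 mulr1 Ty -natr1.
  by rewrite -opprD -mulrDr lerN2 ler_wpM2l//; lra.
(* Failure: [y] stays unvisited, the counter of the top entry grows by one, and the innermost
   induction applies. *)
apply: (@le_trans _ _ (weight T ((v, (x, q.+1)) :: st))).
  apply: ihk.
    rewrite -ltnS; apply: leq_trans qk; rewrite ltnS [ltnRHS](cardD1 y) inE yT ry/= add1n ltnS.
    apply: subset_leq_card; apply/fintype.subsetP => z; rewrite !inE => /andP[zT].
    rewrite zT/= /revealed; case E: edge_between => [e'|//].
    rewrite !inE negb_or => /andP[ne ->]; rewrite andbT.
    by apply: contraNneq ne => zy; move: E; rewrite zy ve => -[->].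
  split => //.
  - move=> i' j e' i'T jT E; rewrite !inE negb_or (I1 _ _ _ i'T jT E) andbT.
    apply/negP => /eqP ee; rewrite ee in E.
    by have [[i'v _]|[_ jv]] := edge_between_inj E ve; move: vT; rewrite -?i'v -?jv ?i'T ?jT.
  - move=> a; rewrite inE => /predU1P[->/=|ast]; last first.
      apply: leq_trans (I2 a _); last by rewrite inE ast orbT.
      apply: subset_leq_card; apply/fintype.subsetP => z; rewrite !inE => /andP[zT].
      by rewrite other// zT.
    have := I2 (v, (x, q)); rewrite mem_head => /(_ isT) /= h.
    apply: (@leq_trans #|[pred z in T | revealed S v z]|.+1); last by rewrite ltnS.
    rewrite (cardD1 y) -add1n leq_add ?leq_b1//.
    apply: subset_leq_card; apply/fintype.subsetP => z; rewrite !inE => /and3P[zy zT].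
    rewrite zT /= /revealed; case E: edge_between => [e'|//].
    rewrite !inE => /predU1P[ee|//]; rewrite ee in E.
    have [[_ zy']|[vy _]] := edge_between_inj E ve; first by rewrite zy' eqxx in zy.
    by move: vT; rewrite vy yT.
  - move=> a; rewrite inE => /predU1P[->//|ast]; apply: I4; by rewrite inE ast orbT.
  - split; first by rewrite /= xt.
    move=> w; rewrite agree_reveal// => /andP[/I6 h _].
    by move: h => /=; case: (st).
rewrite /weight mulrA ler_pM2r ?expR_gt0// -expRD ler_expR !potential_cons/= -natr1.
rewrite le_eqVlt; apply/orP; left; apply/eqP; field.
by rewrite gt_eqF.
Qed.

Lemma product_prob_search : product_prob p bad <= expR (- (s * budget)).
Proof.
have [w0 _|noW] := pickP (@predT Omega); last first.
  by rewrite /product_prob big_pred0 ?expR_ge0// => w; have := noW w.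
rewrite -(cond_prob_set0 p w0).
have -> : expR (- (s * budget)) = weight [set: 'I_n] [::].
  by rewrite /weight /potential big_nil cardsT card_ord subrr mulr0 subr0 mulr0 oppr0 expR0 mul1r.
apply: search_bound; split => // i j e _ _ _; by rewrite inE.
Qed.

End DepthFirstSearch.

(** * Discretisation of the weights *)

Section FiniteMaps.
Context {d : measure_display} {T : measurableType d} {R : realType} (P : probability T R).
Variables (I K : finType) (X : I -> T -> K).
Hypothesis mX : forall i k, measurable [set om | X i om = k].

Let cell (w : {ffun I -> K}) := \bigcap_(i in [set: I]) [set om | X i om = w i].

Let mcell w : measurable (cell w).
Proof. by apply: fin_bigcap_measurable => // i _; exact: mX. Qed.

Let cellP om w : cell w om <-> w = [ffun i => X i om].
Proof.
split=> [h|-> i _ /=]; last by rewrite ffunE.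
by apply/ffunP => i; rewrite ffunE; symmetry; exact: (h i).
Qed.

Let eventE (A : pred {ffun I -> K}) :
  [set om | A [ffun i => X i om]] = \bigcup_(w in [set` enum A]) cell w.
Proof.
apply/seteqP; split=> om /= => [h|[w /=]].
  by exists [ffun i => X i om]; rewrite /= ?mem_enum//; apply/cellP.
by rewrite mem_enum => Aw /cellP wE; rewrite -wE.
Qed.

Lemma measurable_finite_event (A : pred {ffun I -> K}) :
  measurable [set om | A [ffun i => X i om]].
Proof. by rewrite eventE; apply: fin_bigcup_measurable. Qed.

Lemma probability_finite_event (A : pred {ffun I -> K}) :
  P [set om | A [ffun i => X i om]] =
  (\sum_(w | A w) P (\bigcap_(i in [set: I]) [set om | X i om = w i]))%E.
Proof.
rewrite eventE measure_fin_bigcup//; last first.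
  by move=> w w' _ _ [om [/cellP -> /cellP ->]].
by rewrite -fsbig_seq ?enum_uniq// big_enum.
Qed.

End FiniteMaps.

(** * Probabilities of intervals under the exponential law *)

Section ExponentialCells.
Context {R : realType}.
Local Notation mu := lebesgue_measure.

Lemma exponential_prob_itv_le (rate a b : R) : 0 <= rate -> a <= b ->
  (exponential_prob rate `[a, b[ <= (rate * (b - a))%:E)%E.
Proof.
move=> r0 ab; rewrite /exponential_prob.
apply: (@le_trans _ _ (\int[mu]_(x in `[a, b[) (rate%:E))%E).
  apply: ge0_le_integral => //=.
  - by move=> x _; rewrite lee_fin exponential_pdf_ge0.
  - by apply/measurable_EFinP/measurable_funTS; exact: measurable_exponential_pdf.
  - move=> x _; rewrite lee_fin /exponential_pdf patchE; case: ifPn => // xp.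
    rewrite -[leRHS]mulr1 ler_wpM2l// expR_le1 mulNr oppr_le0 mulr_ge0//.
    by move: xp; rewrite inE/= in_itv/= andbT.
rewrite integral_cst//= lebesgue_measure_itv/= lte_fin; case: ifP => h.
  by rewrite -EFinB -EFinM.
by rewrite mule0 lee_fin mulr_ge0// subr_ge0.
Qed.

Lemma exponential_prob_itv_ge (rate a b : R) : 0 <= rate -> 0 <= a -> a <= b ->
  ((rate * expR (- rate * b) * (b - a))%:E <= exponential_prob rate `[a, b[)%E.
Proof.
move=> r0 a0 ab; rewrite /exponential_prob.
apply: (@le_trans _ _ (\int[mu]_(x in `[a, b[) ((rate * expR (- rate * b))%:E))%E).
  rewrite integral_cst//= lebesgue_measure_itv/= lte_fin; case: ifP => h.
    by rewrite -EFinB -EFinM.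
  have -> : a = b by apply/le_anti; rewrite ab leNgt h.
  by rewrite subrr mulr0 mule0.
apply: ge0_le_integral => //=.
- by move=> x _; rewrite lee_fin mulr_ge0// expR_ge0.
- by apply/measurable_EFinP/measurable_funTS; exact: measurable_exponential_pdf.
- move=> x; rewrite in_itv/= => /andP[ax xb]; rewrite lee_fin.
  rewrite exponential_pdfE ?(le_trans a0)//.
  by rewrite ler_wpM2l// ler_expR !mulNr lerN2 ler_wpM2l// ltW.
Qed.

Lemma exponential_prob_negative (rate : R) : exponential_prob rate `]-oo, 0[ = 0%E.
Proof.
rewrite /exponential_prob; apply: integral0_eq => x /=; rewrite in_itv/= => x0.
by rewrite lt0_exponential_pdf.
Qed.

End ExponentialCells.

(** * Rounding a weight to a label *)

Section Discretization.
Context {R : realType}.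
Variables (N J : nat).
Hypothesis N0 : (0 < N)%N.

(* The cap [J] also absorbs the (null) event that a weight is negative. *)
Definition discretize (x : R) : 'I_J.+1 :=
  if (0 <= x) && (N%:R * x < J%:R) then inord (Num.truncn (N%:R * x)) else ord_max.

Let Nr : 0 < N%:R :> R. Proof. by rewrite ltr0n. Qed.

Lemma discretize_cell (k : 'I_J.+1) : (k < J)%N ->
  [set x | discretize x = k] = `[k%:R / N%:R, k.+1%:R / N%:R[%classic.
Proof.
move=> kJ; apply/seteqP; split=> x /=; rewrite in_itv/= ler_pdivrMr// ltr_pdivlMr//.
  rewrite /discretize; case: ifPn => [/andP[x0 xJ] <-|_ kE]; last first.
    by move: kJ; rewrite -kE /= ltnn.
  have NX0 : 0 <= N%:R * x by rewrite mulr_ge0.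
  have /andP[h1 h2] := truncn_itv NX0.
  rewrite inordK; first by rewrite (mulrC x) h1 h2.
  by rewrite ltnS -(ler_nat R) (le_trans h1)// ltW.
move=> /andP[h1 h2]; have x0 : 0 <= x.
  by rewrite -(pmulr_lge0 _ Nr); apply: le_trans h1.
rewrite /discretize x0/= ifT; last first.
  by rewrite mulrC; apply: lt_le_trans h2 _; rewrite ler_nat.
apply: val_inj => /=.
have -> : Num.truncn (N%:R * x) = k.
  by apply: truncn_def; rewrite mulrC h1 h2.
by rewrite inordK// ltnS ltnW.
Qed.

Lemma measurable_discretize_cell (k : 'I_J.+1) : measurable [set x | discretize x = k].
Proof.
have [kJ|Jk] := ltnP k J; first by rewrite discretize_cell.
have -> : [set x | discretize x = k] =
    ~` (\bigcup_(i in [set` [pred i : 'I_J.+1 | (i < J)%N]]) [set x | discretize x = i]).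
  apply/seteqP; split=> x /=.
    by move=> xk [i /= iJ xi]; move: iJ; rewrite inE -xi xk ltnNge Jk.
  move=> h; apply: contrapT => xk; apply: h; exists (discretize x) => //=.
  rewrite inE ltn_neqAle -ltnS ltn_ord andbT; apply: contra_notN xk => /eqP dJ.
  by apply: val_inj; rewrite /= dJ; apply/eqP; rewrite eqn_leq Jk -ltnS ltn_ord.
apply: measurableC; apply: fin_bigcup_measurable => // i /= iJ.
by rewrite discretize_cell.
Qed.

Lemma discretize_le (x : R) : 0 <= x -> (discretize x)%:R <= N%:R * x.
Proof.
move=> x0; rewrite /discretize x0/=; case: ltP => [xJ|//].
have /andP[h1 _] : (Num.truncn (N%:R * x))%:R <= N%:R * x < (Num.truncn (N%:R * x)).+1%:R.
  by apply: truncn_itv; rewrite mulr_ge0.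
by rewrite inordK// ltnS -(ler_nat R) (le_trans h1)// ltW.
Qed.

Lemma discretize_gt (x : R) : (discretize x < J)%N -> N%:R * x < (discretize x).+1%:R.
Proof.
move=> h; have := @discretize_cell (discretize x) h.
move/seteqP => [/(_ x erefl) /=]; rewrite in_itv/= => /andP[_].
by rewrite ltr_pdivlMr// mulrC.
Qed.

End Discretization.

(** * Law of the labels, and measurability *)

Section Transfer.
Context {d : measure_display} {T : measurableType d} {R : realType} (P : probability T R).
Variables (n N J : nat) (W : edge n -> {RV P >-> R}).
Hypotheses (indW : mutually_independent W) (expW : forall e, exp_distributed (W e) n%:R)
  (n1 : (1 < n)%N) (N0 : (0 < N)%N).

Definition cell_prob (k : 'I_J.+1) : R :=
  fine (exponential_prob n%:R^-1 [set x | discretize N J x = k]).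

Definition discretized om : {ffun edge n -> 'I_J.+1} := [ffun e => discretize N J (W e om)].

Let cellE e k : P [set om | discretize N J (W e om) = k] = (cell_prob k)%:E.
Proof.
rewrite /cell_prob -(expW e (measurable_discretize_cell N0 k)) fineK//.
by apply: fin_num_measure; apply: measurable_funPTI; exact: measurable_discretize_cell.
Qed.

Let mcell e k : measurable [set om | discretize N J (W e om) = k].
Proof.
apply: (@measurable_funPTI _ _ _ _ (W e) [set x | discretize N J x = k]).
exact: measurable_discretize_cell.
Qed.

Lemma cell_prob_ge0 k : 0 <= cell_prob k.
Proof. by apply/fine_ge0/integral_ge0 => x _; rewrite lee_fin exponential_pdf_ge0. Qed.

Let e0 : edge n.
Proof.
by exists (Ordinal (ltn_trans (ltn0Sn 0) n1), Ordinal n1).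
Qed.

Lemma cell_prob_sum : \sum_k cell_prob k = 1.
Proof.
apply: EFin_inj; rewrite -sumEFin.
under eq_bigr do rewrite -(cellE e0).
transitivity (\sum_(k <- enum 'I_J.+1) P [set om | discretize N J (W e0 om) = k])%E.
  by rewrite big_enum.
rewrite fsbig_seq ?enum_uniq// -measure_fin_bigcup//.
- rewrite -[RHS](probability_setT P); congr (P _); apply/seteqP; split=> om // _.
  by exists (discretize N J (W e0 om)); rewrite //= mem_enum.
- by move=> k k' _ _ [om [/= <- <-]].
Qed.

Lemma discretized_prob (A : pred {ffun edge n -> 'I_J.+1}) :
  P [set om | A (discretized om)] = (product_prob cell_prob A)%:E.
Proof.
rewrite /discretized (probability_finite_event P (X := fun e om => discretize N J (W e om)))//.
rewrite /product_prob -sumEFin; apply: eq_bigr => w _; rewrite -prodEFin.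
have := indW [set: edge n]%SET (B := fun e => [set x | discretize N J x = w e]).
under eq_bigr do rewrite cellE.
rewrite big_mkcond/=.
under eq_bigr do rewrite inE.
move=> <-; last by move=> e; exact: measurable_discretize_cell.
by congr (P _); apply/seteqP; split=> om h e _; apply: h => //=; rewrite inE.
Qed.

Lemma measurable_discretized (A : pred {ffun edge n -> 'I_J.+1}) :
  measurable [set om | A (discretized om)].
Proof. exact: (measurable_finite_event (X := fun e om => discretize N J (W e om))). Qed.

Lemma cell_prob_le (k : 'I_J.+1) : (k < J)%N -> n%:R * cell_prob k <= N%:R^-1.
Proof.
move=> kJ; have nr : 0 < n%:R :> R by rewrite ltr0n ltnW.
have Nr : 0 < N%:R :> R by rewrite ltr0n.
have ab : k%:R / N%:R <= k.+1%:R / N%:R :> R by rewrite ler_pM2r ?invr_gt0// ler_nat.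
have : ((cell_prob k)%:E <= (n%:R^-1 * N%:R^-1)%:E)%E.
  rewrite -(cellE e0) (expW e0 (measurable_discretize_cell N0 k)) discretize_cell//.
  apply: le_trans (exponential_prob_itv_le _ ab) _; first by rewrite invr_ge0.
  by rewrite lee_fin ler_wpM2l ?invr_ge0// -mulrBl -natrB// subSnn mul1r.
by rewrite lee_fin -ler_pdivlMl.
Qed.

(** On cells below [J] the density is at least [exp (- J / n) / n], and [exp (- x) >= 1 - x]. *)
Lemma cell_prob_ge (k : 'I_J.+1) : (k < J)%N ->
  (1 - J%:R / n%:R) / (n%:R * N%:R) <= cell_prob k.
Proof.
move=> kJ; have nr : 0 < n%:R :> R by rewrite ltr0n ltnW.
have Nr : 0 < N%:R :> R by rewrite ltr0n.
have ab : k%:R / N%:R <= k.+1%:R / N%:R :> R by rewrite ler_pM2r ?invr_gt0// ler_nat.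
rewrite -lee_fin -(cellE e0) (expW e0 (measurable_discretize_cell N0 k)) discretize_cell//.
apply: le_trans (exponential_prob_itv_ge _ _ ab); rewrite ?invr_ge0 ?divr_ge0//.
rewrite lee_fin -mulrBl -natrB// subSnn mul1r.
rewrite invfM mulrA ler_pM2r ?invr_gt0// mulrC ler_pM2l ?invr_gt0//.
apply: le_trans (expR_ge1Dx _); rewrite lerD2l mulNr lerN2 mulrC ler_wpM2r ?invr_ge0//.
rewrite ler_pdivrMr//; apply: (@le_trans _ _ J%:R); first by rewrite ler_nat.
by rewrite ler_peMr// ler1n.
Qed.

Lemma discretized_negative : P [set om | exists e, W e om < 0] = 0%E.
Proof.
have m0 e : measurable [set om | W e om < 0].
  have -> : [set om | W e om < 0] = W e @^-1` `]-oo, 0[%classic.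
    by apply/seteqP; split=> om /=; rewrite in_itv.
  exact: measurable_funPTI.
have -> : [set om | exists e, W e om < 0] = \bigcup_(e in [set: edge n]) [set om | W e om < 0].
  by apply/seteqP; split=> om /=; [case=> e h; exists e|case=> e _ h; exists e].
apply/eqP; rewrite eq_le measure_ge0 andbT.
have h : (P (\bigcup_(e in [set: edge n]) [set om | (W e om < 0)%R]) <= \sum_(e : edge n) P [set om | (W e om < 0)%R])%E.
  have -> : (\sum_(e : edge n) P [set om | (W e om < 0)%R] =
      \sum_(e <- enum {: edge n}) P [set om | (W e om < 0)%R])%E by rewrite big_enum.
  have -> : \bigcup_(e in [set: edge n]) [set om | W e om < 0] =
      \big[setU/set0]_(e <- enum {: edge n}) [set om | W e om < 0].
    rewrite -bigcup_seq; apply/seteqP; split=> om [e /= _ h]; exists e => //=.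
    by rewrite mem_enum.
  elim: (enum {: edge n}) => [|e es ih]; first by rewrite !big_nil measure0.
  rewrite !big_cons; apply: le_trans (leeD2l _ ih).
  by apply: measureU2 => //; exact: bigsetU_measurable.
apply: le_trans h _; rewrite big1// => e _.
have -> : [set om | W e om < 0] = W e @^-1` `]-oo, 0[%classic.
  by apply/seteqP; split=> om /=; rewrite in_itv.
by rewrite (expW e (measurable_itv _)) exponential_prob_negative.
Qed.

Lemma measurable_path_weight (s : seq 'I_n) :
  measurable_fun [set: T] (fun om => path_weight (fun e => W e om) s).
Proof.
elim: s => [|x [|y s] ih] /=; [exact: measurable_cst|exact: measurable_cst|].
apply: measurable_funD => //; rewrite /ew.
by case: insub => [e|]; [|case: insub => [e|]] => //; exact: measurable_cst.
Qed.

(** [Lmax] depends on the weights only through finitely many bits, telling which tuples have average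
    at most [lam]. *)
Lemma measurable_Lmax (lam : R) (Q : pred nat) :
  measurable [set om | Q (Lmax (fun e => W e om) lam)].
Proof.
pose I := {m : 'I_n & m.+1.-tuple 'I_n}.
pose X (i : I) om := path_weight (fun e => W e om) (tagged i) / (tag i : nat)%:R <= lam.
pose G (b : {ffun I -> bool}) : nat :=
  \max_(m < n) \max_(q : m.+1.-tuple 'I_n |
    [&& uniq q, (0 < (m : nat))%N & b (Tagged (fun m : 'I_n => m.+1.-tuple 'I_n) q)]) m.
have LG om : Lmax (fun e => W e om) lam = G [ffun i => X i om].
  by apply: eq_bigr => m _; apply: eq_bigl => q; rewrite ffunE.
have -> : [set om | Q (Lmax (fun e => W e om) lam)] = [set om | Q (G [ffun i => X i om])].
  by apply/seteqP; split=> om /=; rewrite LG.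
apply: (measurable_finite_event (X := X) _ (fun b => Q (G b))) => i b.
have mX : measurable [set om | X i om].
  have -> : [set om | X i om] = [set: T] `&`
      (fun om => path_weight (fun e => W e om) (tagged i) / (tag i : nat)%:R) @^-1` `]-oo, lam]%classic.
    by rewrite setTI; apply/seteqP; split=> om /=; rewrite in_itv.
  apply: measurable_funM; [exact: measurable_path_weight|exact: measurable_cst|by []|].
  exact: measurable_itv.
case: b; first by rewrite (_ : [set om | X i om = true] = [set om | X i om]).
rewrite (_ : [set om | X i om = false] = ~` [set om | X i om]); first exact: measurableC.
by apply/seteqP; split=> om /=; [move=> ->|move/negP/negbTE].
Qed.

End Transfer.

(** * From labels to path lengths *)

Section LongestPath.
Context {R : realType}.
Variables (n : nat) (w : edge n -> R).
Implicit Types (v : 'I_n) (t : seq 'I_n) (lam : R).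

Lemma ewE i j : ew w i j = if edge_between i j is Some e then w e else 0.
Proof. by rewrite /ew /edge_between; case: insub. Qed.

Lemma Lmax_le lam K :
  (forall v t, uniq (v :: t) -> path_weight w (v :: t) <= lam * (size t)%:R -> (size t <= K)%N) ->
  (Lmax w lam <= K)%N.
Proof.
move=> h; apply/bigmax_leqP => m _; apply/bigmax_leqP => q /and3P[uq m0 wq].
have qE : head (widen_ord (ltn_ord m) ord_max) q :: behead q = q.
  by case: q {uq wq} => -[].
have := h (head (widen_ord (ltn_ord m) ord_max) q) (behead q).
rewrite qE size_behead size_tuple => /(_ uq); apply.
by rewrite -ler_pdivrMr ?ltr0n.
Qed.

Lemma Lmax_ge lam v t : uniq (v :: t) -> (0 < size t)%N ->
  path_weight w (v :: t) <= lam * (size t)%:R -> (size t <= Lmax w lam)%N.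
Proof.
move=> us t0 wt.
have tn : (size t < n)%N.
  by have := max_card (mem (v :: t)); rewrite card_ord (card_uniqP us).
have sz : size (v :: t) == (Ordinal tn).+1 by [].
apply: (leq_trans _ (leq_bigmax_cond (Ordinal tn) _)) => //.
apply: (leq_trans _ (@leq_bigmax_cond _ _ _ (Tuple sz) _)) => //=.
apply/and3P; split => //.
by rewrite ler_pdivrMr// ltr0n.
Qed.

Variables (N J : nat).
Hypothesis N0 : (0 < N)%N.
Variable dw : {ffun edge n -> 'I_J.+1}.
Hypothesis dwE : forall e, dw e = discretize N J (w e).

Fixpoint label v t : seq ('I_n * 'I_J.+1) :=
  if t is y :: t' then
    (y, if edge_between v y is Some e then dw e else ord0) :: label y t'
  else [::].

Lemma map_fst_label v t : map fst (label v t) = t.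
Proof. by elim: t v => //= y t ih v; rewrite ih. Qed.

Lemma follows_label v t : follows dw (labelled_edges v (label v t)).
Proof.
elim: t v => //= y t ih v; case: edge_between => [e|] //=.
by rewrite /follows /= eqxx; exact: ih.
Qed.

Lemma label_sum_le v t : (forall e, 0 <= w e) ->
  (label_sum (label v t))%:R <= N%:R * path_weight w (v :: t).
Proof.
move=> w0; elim: t v => [|y t ih] v; first by rewrite /label_sum big_nil mulr0.
rewrite [label v (y :: t)]/= [path_weight _ _]/= /label_sum big_cons/= natrD mulrDr lerD//; last exact: ih.
rewrite ewE; case: edge_between => [e|]; last by rewrite mulr0.
by rewrite dwE; apply: discretize_le.
Qed.

Lemma Lmax_le_of_discretized lam l K : (forall e, 0 <= w e) -> N%:R * lam <= l%:R ->
  ~ (exists v s, [/\ uniq (v :: map fst s), follows dw (labelled_edges v s),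
       (label_sum s <= l * size s)%N & (K < size s)%N]) ->
  (Lmax w lam <= K)%N.
Proof.
move=> w0 lamN h; apply: Lmax_le => v t us wt; rewrite leqNgt; apply/negP => Kt.
have sz : size (label v t) = size t by rewrite -{2}(map_fst_label v t) size_map.
apply: h; exists v, (label v t); split; rewrite ?map_fst_label ?sz//.
  exact: follows_label.
rewrite -(ler_nat R); apply: le_trans (label_sum_le v t w0) _.
apply: le_trans (ler_wpM2l _ wt) _ => //.
by rewrite natrM mulrA ler_wpM2r.
Qed.

(** Each label is a difference of consecutive heights plus [l], so the labels telescope; the extra 1
    in [l.+1] is the rounding error of one edge. Heights below [hi <= J] exclude the cap label,
    which gives no upper bound on a weight. *)
Lemma chain_weight_le l hi a st : (hi <= J)%N -> chain l dw (a :: st) ->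
  all (fun a => in_tube l hi a.2.1) (a :: st) ->
  N%:R * path_weight w (map fst (a :: st)) <= (a.2.1 + size st * l.+1)%:R.
Proof.
move=> hJ; elim: st a => [|b st ih] a; first by rewrite /= mulr0.
rewrite [chain _ _ _]/= => /andP[+ ch] /= /andP[/andP[_ ahi] /[dup] tb /andP[/andP[lb bhi] _]].
have {}ih := ih b ch tb; rewrite ewE edge_betweenC.
case: edge_between => // e /eqP aE; rewrite mulrDr.
have dJ : (discretize N J (w e) < J)%N.
  by rewrite -dwE; move: ahi; rewrite aE; lia.
have h := ltW (discretize_gt N0 dJ); rewrite -dwE in h.
apply: (le_trans (lerD h ih)); rewrite -natrD ler_nat aE.
lia.
Qed.

Lemma Lmax_ge_of_chain lam l hi m0 st : (hi <= J)%N -> uniq (map fst st) ->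
  all (fun a => in_tube l hi a.2.1) st -> chain l dw st -> (1 < m0 <= size st)%N ->
  (forall m, (m0.-1 <= m)%N -> (hi + m * l.+1)%:R <= N%:R * (lam * m%:R)) ->
  (m0.-1 <= Lmax w lam)%N.
Proof.
move=> hJ us tube ch /andP[m1 mst] hm.
case: st us tube ch mst => [|a st] us tube ch mst; first by move: mst; rewrite leqNgt ltnW.
have mst' : (m0.-1 <= size st)%N by move: mst => /=; lia.
have wt := chain_weight_le hJ ch tube.
apply: (leq_trans mst'); rewrite -(size_map fst st).
apply: (Lmax_ge (v := a.1)) => //; rewrite size_map; first by lia.
rewrite -(@ler_pM2l _ N%:R) ?ltr0n//; apply: le_trans wt _.
apply: le_trans (hm _ mst'); rewrite ler_nat leq_add2r ltnW//.
by move: tube => /= /andP[/andP[]].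
Qed.

End LongestPath.

Section SineBetween.
Context {R : realType}.

Lemma sin_ge_endpoint (a x : R) : 0 <= a -> a <= x -> x <= pi - a -> sin a <= sin x.
Proof.
move=> a0 ax xa; have pi0 := pi_gt0 R.
wlog xh : x ax xa / x <= pi / 2.
  move=> H; have [/H->//|xh] := leP x (pi / 2).
  have -> : sin x = sin (pi - x) by rewrite sinB sinpi cospi mul0r sub0r mulN1r opprK.
  by apply: H; lra.
have := @ltr_sin R x a; rewrite !in_itv/= => h.
by rewrite leNgt h ?ltNge ?ax//; lra.
Qed.

End SineBetween.

(** * A long stack in a supercritical tube *)

Section ChainExistence.
Context {R : realType}.
Variables (n l B N J : nat) (p : 'I_J.+1 -> R) (th tau : R).
Hypotheses (p0 : forall k, 0 <= p k) (p1 : \sum_k p k = 1)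
  (pN : forall k : 'I_J.+1, (k < J)%N -> (1 - J%:R / n%:R) / (n%:R * N%:R) <= p k).
Hypotheses (n1 : (1 < n)%N) (N0 : (0 < N)%N) (l0 : (0 < l)%N) (B1 : (1 < B)%N)
  (hJ : (l + B <= J)%N) (Jn : J%:R <= tau * n%:R)
  (th0 : 0 < th) (th1 : l.+1%:R * th <= 1) (Bpi : B%:R * th = pi)
  (tau0 : 0 < tau) (tau1 : 2 * tau <= 1)
  (supercritical : 1 <= (1 - tau) ^+ 5 * (growth l th / N%:R)).

(** The ratio of the bounds [umin] and [umax] of the subsolution on the tube; up to powers of [tau]
    it is the fraction of the vertices found on the stack. *)
Definition chain_density : R := tilt l th ^+ B * sin th.

Let thpi := angle_lt_pi th1.
Let r0 : 0 < tilt l th := tilt_gt0 l0 th0 thpi.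
Let u y := tilt l th ^+ y * sin ((y%:R - l%:R) * th).
Let umax := tilt l th ^+ l.
Let umin := umax * chain_density.
Let eps := tau * umin.
Let s := tau / umax.
Let n' := (1 - tau) * n%:R.
Let nr : 0 < n%:R :> R. Proof. by rewrite ltr0n ltnW. Qed.
Let Nr : 0 < N%:R :> R. Proof. by rewrite ltr0n. Qed.
Let umax0 : 0 < umax. Proof. exact: exprn_gt0. Qed.
Let s0 : 0 < s. Proof. exact: divr_gt0. Qed.
Let tau_lt1 : tau < 1. Proof. by move: tau0 tau1; move: (tau) => t; lra. Qed.
Let n'0 : 0 < n'. Proof. by rewrite mulr_gt0// subr_gt0. Qed.

Let th_le_half : th <= pi - th.
Proof.
have : 2 * th <= pi by rewrite -Bpi ler_wpM2r ?ler_nat// ltW.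
by move: (th) => t; lra.
Qed.

Let sin_th : 0 < sin th.
Proof.
by apply: sin_gt0_pi; move: th0 th_le_half; move: (th) => t; lra.
Qed.

Lemma chain_density_gt0 : 0 < chain_density.
Proof. by rewrite mulr_gt0// exprn_gt0. Qed.

Let umin0 : 0 < umin. Proof. by rewrite mulr_gt0// chain_density_gt0. Qed.
Let eps0 : 0 < eps. Proof. exact: mulr_gt0. Qed.

Let u_le y : (l < y < l + B)%N -> u y <= umax.
Proof.
move=> /andP[ly _]; rewrite /u /umax -[leRHS]mulr1; apply: le_trans (_ : _ <= tilt l th ^+ y * 1) _.
  by rewrite ler_wpM2l ?sin_le1// exprn_ge0// ltW.
rewrite !mulr1 -(subnKC (ltnW ly)) exprD ler_piMr ?exprn_ge0 ?(ltW r0)//.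
by rewrite exprn_ile1 ?(ltW r0)//; exact: tilt_le1.
Qed.

Let u_ge y : (l < y < l + B)%N -> umin <= u y.
Proof.
move=> /andP[ly yB]; rewrite /umin /u /umax /chain_density mulrA -exprD.
apply: ler_pM; rewrite ?exprn_ge0 ?(ltW r0) ?(ltW sin_th)//.
  rewrite -(subnKC (ltnW yB)) exprD ler_piMr ?exprn_ge0 ?(ltW r0)//.
  by rewrite exprn_ile1 ?(ltW r0)//; exact: tilt_le1.
rewrite -natrB ?(ltnW ly)//; apply: sin_ge_endpoint; first exact: ltW.
  by rewrite -[leLHS]mul1r ler_wpM2r ?(ltW th0)// ler1n subn_gt0.
rewrite -Bpi lerBrDr -{2}[th]mul1r -mulrDl ler_wpM2r ?(ltW th0)// natr1 ler_nat.
by move: ly yB; clear; lia.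
Qed.

Let one_minus_expN (z : R) : 0 <= z -> z * (1 - z) <= 1 - expR (- z).
Proof.
move=> z0; have h : expR (- z) <= (1 + z)^-1.
  by rewrite expRN lef_pV2 ?posrE ?expR_gt0 ?expR_ge1Dx//; lra.
have h2 : (1 + z)^-1 <= 1 - z + z ^+ 2.
  rewrite -[leLHS]mul1r ler_pdivrMr; last by lra.
  have : 0 <= z ^+ 3 by rewrite exprn_ge0.
  nra.
lra.
Qed.

Let expR_sub1_le (a : R) : 0 <= a -> a <= tau -> expR a - 1 <= a / (1 - tau).
Proof.
move: (tau) tau_lt1 => t t1 a0 at'; have a1 : 0 < 1 - a by lra.
have h : expR a <= (1 - a)^-1.
  rewrite -[leLHS]invrK -expRN lef_pV2 ?posrE ?expR_gt0//.
  exact: expR_ge1Dx.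
apply: (@le_trans _ _ (a * (1 - a)^-1)).
  rewrite (_ : a * _ = (1 - a)^-1 - 1); last by field; lra.
  by rewrite lerD2r.
by rewrite ler_wpM2l// lef_pV2 ?posrE; lra.
Qed.

(** The five factors [1 - tau] of [supercritical] pay for the cell probabilities, for [u - eps]
    against [u], for [1 - exp (- z)] against [z], for [n'] against [n], and for [exp a - 1] against
    [a]. *)
Let search_step x : in_tube l (l + B) x -> expR (s * u x / n') - 1 <=
  \sum_(k : 'I_J.+1 | in_tube l (l + B) (x - l + k)%N)
     p k * (1 - expR (- (s * (u (x - l + k)%N - eps)))).
Proof.
move=> xt; have ux0 : 0 < u x by apply: lt_le_trans (u_ge xt).
have t1 : 0 < 1 - tau by rewrite subr_gt0.
have a0 : 0 <= s * u x / n' := divr_ge0 (ltW (mulr_gt0 s0 ux0)) (ltW n'0).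
have sum_tau : s * u x <= tau.
  by rewrite /s mulrAC ler_pdivrMr// ler_wpM2l ?(ltW tau0)// u_le.
have a1 : s * u x / n' <= tau.
  rewrite ler_pdivrMr//; apply: le_trans sum_tau _; rewrite ler_peMr ?(ltW tau0)//.
  have : 2 <= n%:R :> R by rewrite ler_nat.
  by rewrite /n'; move: tau0 tau1; move: (tau) (n%:R) => t m; nra.
apply: le_trans (expR_sub1_le a0 a1) _.
pose c := (1 - tau) / (n%:R * N%:R) * (s * (1 - tau) ^+ 2).
apply: (@le_trans _ _ (c * (growth l th * u x))).
  have -> : s * u x / n' / (1 - tau) = s * u x / (n%:R * (1 - tau) ^+ 2).
    by rewrite /n'; field; rewrite !gt_eqF.
  have -> : c * (growth l th * u x) =
      s * u x / (n%:R * (1 - tau) ^+ 2) * ((1 - tau) ^+ 5 * (growth l th / N%:R)).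
    by rewrite /c; field; rewrite !gt_eqF.
  by rewrite ler_peMr// ltW//; apply: divr_gt0; apply: mulr_gt0 => //; exact: exprn_gt0.
have c0 : 0 <= c.
  by apply: mulr_ge0; [apply: divr_ge0; rewrite ?mulr_ge0|apply: mulr_ge0; rewrite ?exprn_ge0]; rewrite ?ltW.

apply: le_trans (ler_wpM2l c0 (kernel_tube_ge l0 th0 thpi Bpi xt hJ)) _.
rewrite mulr_sumr [leRHS]big_mkcond big_ord_recr/= -[leLHS]addr0; apply: lerD.
  rewrite [leLHS]big_mkcond; apply: ler_sum => k _.
  rewrite -[in_tube _ _ _]/((l < x - l + k < l + B)%N); case: ifPn => // yt.
  set z := s * (u _ - eps).
  have uz := u_ge yt.
  have uz' : (1 - tau) * u (x - l + k) <= u (x - l + k)%N - eps.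
    by rewrite mulrBl mul1r lerD2l lerN2 /eps; apply: ler_wpM2l => //; exact: ltW.
  have z0 : s * (1 - tau) * u (x - l + k) <= z.
    by rewrite -(mulrA s); apply: ler_wpM2l; [exact: ltW|exact: uz'].
  have z1 : z <= tau.
    apply: (@le_trans _ _ (s * u (x - l + k))).
      by apply: ler_wpM2l; [exact: ltW|rewrite gerBl ltW].
    by rewrite /s mulrAC ler_pdivrMr// ler_wpM2l ?(ltW tau0)// u_le.
  have uy0 : 0 <= s * (1 - tau) * u (x - l + k)%N.
    by apply: ltW; apply: mulr_gt0; [exact: mulr_gt0|exact: lt_le_trans uz].
  rewrite /c -(mulrA ((1 - tau) / (n%:R * N%:R))). apply: ler_pM.
  - by apply: ltW; apply: divr_gt0 => //; exact: mulr_gt0.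
  - by apply: mulr_ge0; [apply: mulr_ge0; [exact: ltW|apply: exprn_ge0; exact: ltW]|exact: ltW (lt_le_trans umin0 uz)].
  - apply: le_trans (pN (k := widen_ord (leqnSn J) k) (ltn_ord k)).
    rewrite ler_wpM2r ?invr_ge0 ?mulr_ge0 ?(ltW nr) ?(ltW Nr)// lerD2l lerN2.
    by rewrite ler_pdivrMr.
  - apply: le_trans (one_minus_expN (le_trans uy0 z0)).
    rewrite (_ : s * _ * _ = s * (1 - tau) * u (x - l + k)%N * (1 - tau)); last by rewrite /u; ring.
    by apply: ler_pM => //; [exact: ltW|rewrite lerD2l lerN2].
rewrite ifF//; apply/negbTE; rewrite negb_and -!leqNgt; apply/orP; right.
by move: xt hJ => /andP[]; clear; lia.
Qed.

(** Half of [eps * (n - n') / umax], rounded down: the other half of the budget remains for the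
    exponent. *)
Definition chain_length : nat := Num.truncn (tau ^+ 2 * chain_density * n%:R / 2).

Lemma product_prob_no_chain :
  product_prob p (fun w => `[< ~ exists st : seq ('I_n * (nat * nat)),
     [/\ uniq (map fst st), all (fun a => in_tube l (l + B) a.2.1) st,
         chain l w st & (chain_length <= size st)%N] >]) <=
  expR (- (tau ^+ 3 * chain_density / 2 * n%:R)).
Proof.
have root_tube : in_tube l (l + B) l.+1 by rewrite /in_tube ltnSn/= -addn1 ltn_add2l.
have bd : tau ^+ 3 * chain_density / 2 * n%:R <= s * budget n umax eps n' chain_length.
  have m0 : chain_length%:R * umax <= tau ^+ 2 * chain_density * n%:R / 2 * umax.
    rewrite ler_wpM2r ?(ltW umax0)// truncn_le//.
    by rewrite ltW// !mulr_gt0 ?exprn_gt0 ?chain_density_gt0 ?invr_gt0.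
  rewrite /budget; have -> : tau ^+ 3 * chain_density / 2 * n%:R =
    s * (eps * (n%:R - n') - tau ^+ 2 * chain_density * n%:R / 2 * umax).
    by rewrite /s /eps /umin /n'; field; rewrite gt_eqF.
  by rewrite ler_wpM2l ?(ltW s0)// lerD2l lerN2.
apply: le_trans (_ : _ <= expR (- (s * budget n umax eps n' chain_length))) _; last first.
  by rewrite ler_expR lerN2.
apply: (product_prob_search p0 p1 (u := u) (ltW s0) (ltW eps0) n'0 (ltW umax0)
  _ u_le search_step) => [x xt|w st us tube ch big|].
- apply: le_trans (u_ge xt); rewrite /eps ler_piMl ?(ltW umin0)//; exact: ltW.
- by apply/asboolP; apply; exists st.
- exact: (root_tube : in_tube l (l + B) l.+1).
Qed.

End ChainExistence.

(** * Choice of the parameters *)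

Section TubeParameters.
Context {R : realType}.

Lemma pow_le_expR (K c : R) k : 0 <= K -> 0 < c ->
  exists z0, forall z, z0 <= z -> K * z ^+ k <= expR (c * z).
Proof.
move=> K0 c0; exists (Num.max 0 (K * (k.+1)`!%:R / c ^+ k.+1)) => z.
rewrite ge_max => /andP[z0 zK].
have f0 : 0 < (k.+1)`!%:R :> R by rewrite ltr0n fact_gt0.
have := @expR_ge1Dxn R (c * z) k; rewrite mulr_ge0 ?(ltW c0)// => /(_ isT) h.
apply: (@le_trans _ _ ((c * z) ^+ k.+1 / (k.+1)`!%:R)); last by lra.
rewrite ler_pdivlMr// exprMn (exprS z).
rewrite ler_pdivrMr ?exprn_gt0// in zK.
rewrite (_ : K * z ^+ k * _ = (K * (k.+1)`!%:R) * z ^+ k); last by ring.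
rewrite (_ : c ^+ k.+1 * (z * z ^+ k) = (z * c ^+ k.+1) * z ^+ k); last by ring.
by rewrite ler_wpM2r// exprn_ge0.
Qed.

Lemma tiltVX_le l m (th : R) : (0 < l)%N -> 0 < th -> l.+1%:R * th <= 1 ->
  (tilt l th ^+ m)^-1 <= expR (m%:R / l%:R).
Proof.
move=> l0 th0 th1; have r0 := tilt_gt0 l0 th0 (angle_lt_pi th1).
rewrite mulrC expRM_natr -exprVn lerXn2r ?nnegrE ?invr_ge0 ?expR_ge0 ?(ltW r0)//.
exact: le_trans (tiltV_le l0 th0 th1) (expR_ge1Dx _).
Qed.

Lemma expRN1_ge : 4^-1 <= expR (- 1 : R).
Proof. by rewrite expRN lef_pV2 ?posrE ?expR_gt0 ?ltr0n// expR1_le4. Qed.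

Lemma expRN1_le : expR (- 1 : R) <= 2^-1.
Proof. by rewrite expRN lef_pV2 ?posrE ?expR_gt0 ?ltr0n// expR1_ge2. Qed.

Lemma truncnS_bounds (x : R) : 0 <= x -> x <= (Num.truncn x).+1%:R <= x + 1.
Proof.
move=> x0; have /andP[h1 h2] := truncn_itv x0.
by rewrite ltW//= -natr1 lerD2r.
Qed.

Lemma low_weight_parameters : exists z0 : R, forall z, z0 <= z ->
  exists N l D L : nat,
    [/\ (0 < N)%N, (0 < L)%N, (0 < l <= D)%N,
        N%:R * (expR (-1) + z ^- 2) <= l%:R &
        forall n (p : 'I_(l + D.*2).+1 -> R), (forall k, 0 <= p k) ->
        (forall k : 'I_(l + D.*2).+1, (k < l + D.*2)%N -> n%:R * p k <= N%:R^-1) ->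
        expR 1 * low_weight n l D.*2 p L (l + D) <= expR (- (z / 128)) / (6 * L%:R)].
Proof.
have [|z1 hz1] := @pow_le_expR 384 64^-1 4 (ler0n _ _); first by rewrite invr_gt0.
exists (Num.max 64 z1) => z; rewrite ge_max => /andP[z64 /hz1 {hz1} zexp].
have z0 : 0 < z by lra.
pose eta : R := z ^- 2; rewrite -/eta.
have etaz : eta * z ^+ 2 = 1 by rewrite /eta mulVf// expf_neq0// gt_eqF.
have eta0 : 0 < eta by rewrite invr_gt0 exprn_gt0.
have z2 : z <= z ^+ 2 by rewrite expr2 ler_peMl ?(ltW z0)//; lra.
have eta1 : eta * 64 <= 1 by rewrite -[leRHS]etaz ler_wpM2l ?(ltW eta0)// (le_trans z64).
have e4 := expRN1_ge; have e2 := expRN1_le.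
have ee : expR 1 * expR (-1) = 1 :> R by rewrite expRxMexpNx_1.
have E2 := @expR1_ge2 R; have E4 := @expR1_le4 R.
set lam := expR (-1) + eta.
have lam4 : 4^-1 <= lam by rewrite /lam; lra.
have z20 : 0 <= 8 * z ^+ 2 by rewrite mulr_ge0// exprn_ge0// ltW.
have /andP[N1 _] := truncnS_bounds z20; set N := (Num.truncn _).+1 in N1.
have Nr : 0 < N%:R :> R by rewrite ltr0n.
have Neta : 8 <= N%:R * eta by nra.
have lam0 : 0 <= N%:R * lam by rewrite mulr_ge0 ?(ltW Nr)//; lra.
have /andP[l1 l2] := truncnS_bounds lam0; set l := (Num.truncn _).+1 in l1 l2.
have lz2 : z <= l%:R by nra.
have lr : 64 <= l%:R :> R by lra.
(* Half width [D] about [l z / 16], duration [L] about [z ^+ 3 / 128]: then [l th >= 8 / z], and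
   killing costs [16 eta] per step against a gain of [5 eta]. *)
have D0 : 0 <= l%:R * z / 16 by rewrite divr_ge0// mulr_ge0//; lra.
have /andP[D1 D2] := truncnS_bounds D0; set D := (Num.truncn _).+1 in D1 D2.
have L0 : 0 <= z ^+ 3 / 128 by rewrite divr_ge0// exprn_ge0// ltW.
have /andP[L1 L2] := truncnS_bounds L0; set L := (Num.truncn _).+1 in L1 L2.
have lD : (l <= D)%N by rewrite -(ler_nat R); nra.
exists N, l, D, L; split => // n p p0 pN.
pose Q : R := (D.*2 + l.*2.+1)%:R.
have QE : Q = 2 * D%:R + 2 * l%:R + 1.
  by rewrite /Q natrD -addn1 natrD -!muln2 !natrM; ring.
have Q0 : 0 < Q by rewrite QE; lra.
pose th : R := pi / Q.
have pi2 := @pi_ge2 R; have pi4 : pi < 4 :> R by have := @pihalf_lt2 R; lra.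
have th0 : 0 < th by rewrite divr_gt0// pi_gt0.
have thQ : (D.*2 + l.*2.+1)%:R * th = pi by rewrite /th -/Q mulrC divfK// gt_eqF.
have l1r : l.+1%:R = l%:R + 1 :> R by rewrite -natr1.
have thQ' : Q * th = pi by exact: thQ.
have th1 : l.+1%:R * th <= 1.
  rewrite l1r /th mulrA ler_pdivrMr// mul1r QE; nra.
have ltr : 8 / z <= l%:R * th.
  rewrite ler_pdivrMr// /th mulrA mulrAC ler_pdivlMr// QE; nra.
set t := l%:R * th in ltr.
have t0 : 0 < t by apply: lt_le_trans ltr; rewrite divr_gt0.
have t2 : 64 * eta <= t ^+ 2.
  have -> : 64 * eta = (8 / z) ^+ 2 by rewrite /eta; field; rewrite gt_eqF.
  by rewrite lerXn2r ?nnegrE// ?(ltW t0)// divr_ge0// ltW.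
have thpi := angle_lt_pi th1.
have r0 := tilt_gt0 (ltn0Sn _) th0 thpi : 0 < tilt l th.
have r1 : tilt l th <= 1 by exact: tilt_le1.
have A1 : 1 <= expR (5 * eta) by apply: le_trans (expR_ge1Dx _); rewrite lerDl mulr_ge0 ?(ltW eta0).
have AN : expR 1 * l.+1%:R / N%:R <= expR (5 * eta).
  apply: le_trans (expR_ge1Dx _); rewrite ler_pdivrMr// l1r.
  have : expR 1 * (l%:R + 1) <= expR 1 * (N%:R * lam + 2) by rewrite ler_wpM2l ?expR_ge0//; lra.
  rewrite /lam => h; apply: le_trans h _.
  have -> : expR 1 * (N%:R * (expR (-1) + eta) + 2) = N%:R * (expR 1 * expR (-1)) + expR 1 * (N%:R * eta + 2) by ring.
  rewrite ee; clear - Neta E4 eta0 Nr; nra.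
have sin0 : 0 < sin (l.+1%:R * th) by apply: sin_gt0_pi; rewrite thpi mulr_gt0.
pose umin := tilt l th ^+ (l + D.*2) * sin (l.+1%:R * th).
have umin0 : 0 < umin by rewrite mulr_gt0// exprn_gt0.
have uminP y : (l < y <= l + D.*2)%N -> umin <= tilt l th ^+ y * sin (y%:R * th).
  move=> /andP[ly yD]; apply: ler_pM; rewrite ?exprn_ge0 ?(ltW r0) ?(ltW sin0)//.
    by rewrite -(subnKC yD) exprD ler_piMr ?exprn_ge0 ?exprn_ile1 ?(ltW r0).
  apply: sin_ge_endpoint; first by rewrite ltW// mulr_gt0.
    by rewrite ler_wpM2r ?(ltW th0)// ler_nat.
  rewrite -thQ -mulrBl ler_wpM2r ?(ltW th0)// -natrB; last first.
    by move: (D) (l); clear; lia.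
  by rewrite ler_nat; move: (D) (l) yD; clear; lia.
have D0n : (0 < D)%N by [].
have xH : (l < l + D <= l + D.*2)%N by move: (D) (l) D0n; clear; lia.
have W := low_weight_bound p0 pN (leqnn _) L (ltn0Sn _) (ltn0Sn _) th0 thpi thQ A1 AN umin0 uminP xH.
have Lr : z ^+ 3 / 128 * eta = z / 128 by rewrite /eta; field; rewrite gt_eqF.
(* Exits through the bottom: descending by [D] costs about [exp (- z / 16)], against a gain of about
   [exp (5 z / 128)] over [L] steps. *)
have W1 : expR (5 * eta) ^+ L * (l%:R / l.+1%:R) ^+ (l + D - l) <= expR (2 - 3 / 128 * z).
  rewrite addKn -expRM_natl.
  have h : l%:R / l.+1%:R <= expR (- (l.+1%:R)^-1) :> R.
    have S0 : 0 < l%:R + 1 :> R by clear - lr; lra.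
    apply: le_trans (expR_ge1Dx _).
    by rewrite l1r ler_pdivrMr// mulrBl mul1r mulVf ?gt_eqF// addrK.
  apply: (@le_trans _ _ (expR (L%:R * (5 * eta)) * expR (- (l.+1%:R)^-1) ^+ D)).
    by rewrite ler_wpM2l ?expR_ge0// lerXn2r ?nnegrE ?expR_ge0 ?divr_ge0.
  rewrite -expRM_natl -expRD ler_expR.
  have hL : L%:R * (5 * eta) <= 5 * z / 128 + 1.
    have : L%:R * eta <= (z ^+ 3 / 128 + 1) * eta by rewrite ler_wpM2r// ltW.
    rewrite mulrDl Lr mul1r; clear - eta1; lra.
  have hD : z / 16 - 1 <= D%:R / l.+1%:R.
    rewrite ler_pdivlMr ?ltr0n// l1r; clear - D1 lz2 z0; nra.
  rewrite mulrN; apply: le_trans (lerB hL hD) _; clear -z0; lra.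
(* Survival for [L] steps at net rate [- 11 eta]. *)
have W2 : (growth l th / N%:R) ^+ L <= expR (- (11 / 128 * z)).
  have g1 : growth l th / N%:R <= expR (- (11 * eta)).
    apply: (@le_trans _ _ (expR (5 * eta) * expR (- (t ^+ 2 / 4)))).
      rewrite ler_pdivrMr//; apply: le_trans (growth_le (ltn0Sn _) th0 th1) _.
      rewrite -/t expRD mulrA [leRHS]mulrAC ler_wpM2r ?expR_ge0//.
      by rewrite mulrC -ler_pdivrMr.
    by rewrite -expRD ler_expR; clear - t2; lra.
  apply: (@le_trans _ _ (expR (- (11 * eta)) ^+ L)).
    rewrite lerXn2r ?nnegrE ?expR_ge0// divr_ge0 ?(ltW Nr)//.
    exact: ltW (growth_gt0 (ltn0Sn _) th0 thpi).
  rewrite -expRM_natl ler_expR.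
  have : z ^+ 3 / 128 * eta <= L%:R * eta by rewrite ler_wpM2r// ltW.
  by rewrite Lr mulrN lerN2 mulrCA; clear; lra.
(* The tilt across half the tube costs [exp (z / 16 + 1)], and the sine at its edge is at least
   [4 / z]. With [W2] this gives the exponent [- 3 z / 128] of [W1] again. *)
have W3 : tilt l th ^+ (l + D) * sin ((l + D)%:R * th) / umin <= expR (z / 16 + 1) * (z / 4).
  have hs : 4 / z <= sin (l.+1%:R * th).
    apply: (@le_trans _ _ (l.+1%:R * th * (1 - (l.+1%:R * th) ^+ 2 / 2))); last first.
      by apply: sin_ge_cubic; rewrite (ltW thpi) mulr_ge0 ?ltW.
    have h1 : 8 / z <= l.+1%:R * th.
      by apply: (le_trans ltr); rewrite ler_wpM2r ?(ltW th0)// ler_nat.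
    have h2 : 4 / z = (8 / z) / 2 by field; rewrite gt_eqF.
    rewrite h2; apply: (@le_trans _ _ (l.+1%:R * th / 2)); first by rewrite ler_wpM2r ?invr_ge0.
    apply: ler_wpM2l; first by rewrite ltW// mulr_gt0.
    have : (l.+1%:R * th) ^+ 2 <= 1 by rewrite expr_le1// ltW// mulr_gt0.
    by move: ((l.+1%:R * th) ^+ 2) => b b1; clear - b1; lra.
  rewrite ler_pdivrMr//.
  apply: (@le_trans _ _ (tilt l th ^+ (l + D) * 1)).
    by rewrite ler_wpM2l ?exprn_ge0 ?(ltW r0)// sin_le1.
  rewrite mulr1 /umin (_ : l + D.*2 = (l + D) + D)%N; last by rewrite -addnn addnA.
  rewrite (exprD _ (l + D) D).
  have hT : 1 <= expR (z / 16 + 1) * tilt l th ^+ D.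
    rewrite -ler_pdivrMr ?exprn_gt0// div1r.
    apply: le_trans (tiltVX_le D (ltn0Sn _) th0 th1) _; rewrite ler_expR.
    rewrite ler_pdivrMr ?ltr0n//; apply: le_trans D2 _.
    have -> : l%:R * z / 16 = z / 16 * l%:R :> R by rewrite -mulrA mulrC.
    by rewrite mulrDl mul1r lerD2l; apply: le_trans lr; rewrite ler1n.
  have hS : 1 <= z / 4 * sin (l.+1%:R * th).
    rewrite mulrC -ler_pdivrMr ?divr_gt0// div1r invf_div.
    exact: hs.
  have -> : expR (z / 16 + 1) * (z / 4) * (tilt l th ^+ (l + D) * tilt l th ^+ D * sin (l.+1%:R * th)) =
     tilt l th ^+ (l + D) * ((expR (z / 16 + 1) * tilt l th ^+ D) * (z / 4 * sin (l.+1%:R * th))) by ring.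
  rewrite ler_peMr ?exprn_ge0 ?(ltW r0)//.
  by apply: (@le_trans _ _ (1 * 1)); [rewrite mulr1|apply: ler_pM].
have W4 : low_weight n l D.*2 p L (l + D) <= expR (2 - 3 / 128 * z) * z.
  apply: (le_trans W).
  apply: (@le_trans _ _ (expR (2 - 3 / 128 * z) + expR (2 - 3 / 128 * z) * (z / 4))).
    apply: lerD => //.
    apply: (@le_trans _ _ (expR (- (11 / 128 * z)) * (expR (z / 16 + 1) * (z / 4)))).
      apply: ler_pM => //.
        by rewrite exprn_ge0// divr_ge0 ?(ltW Nr)//; exact: ltW (growth_gt0 (ltn0Sn _) th0 thpi).
      by rewrite divr_ge0 ?(ltW umin0)//; apply: le_trans (uminP _ xH); exact: ltW.
    rewrite mulrA -expRD ler_wpM2r ?divr_ge0 ?(ltW z0)//.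
    by rewrite ler_expR; clear; lra.
  rewrite -[X in X + _]mulr1 -mulrDr ler_wpM2l ?expR_ge0//; clear - z64; lra.
rewrite ler_pdivlMr; last by rewrite mulr_gt0 ?ltr0n.
apply: (@le_trans _ _ (expR 1 * (expR (2 - 3 / 128 * z) * z) * (6 * L%:R))).
  by rewrite ler_wpM2r// ler_wpM2l ?expR_ge0.
have Lz : L%:R <= z ^+ 3.
  apply: (le_trans L2); have : 2 <= z ^+ 3.
    have z1' : 1 <= z by apply: le_trans z64; rewrite ler1n.
    by rewrite exprS; apply: le_trans (ler_peMr (ltW z0) (exprn_ege1 2 z1')); clear - z64; lra.
  clear; lra.
(* The spare factor [exp (z / 64)] absorbs the polynomial [384 z ^+ 4]. *)
have -> : expR (- (z / 128)) = expR (- (3 / 128 * z)) * expR (64^-1 * z).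
  by rewrite -expRD; congr expR; clear; lra.
rewrite expRB (_ : 2 = 1 + 1)// expRD -expRN.
apply: (@le_trans _ _ (expR (- (3 / 128 * z)) * (384 * z ^+ 4))); last first.
  by rewrite ler_wpM2l// expR_ge0.
have -> : expR 1 * (expR 1 * expR 1 * expR (- (3 / 128 * z)) * z) * (6 * L%:R) =
  expR (- (3 / 128 * z)) * (6 * (expR 1 * expR 1 * expR 1) * (z * L%:R)) by ring.
rewrite ler_wpM2l ?expR_ge0//.
have -> : 384 * z ^+ 4 = 6 * (4 * 4 * 4) * (z * z ^+ 3) :> R by ring.
apply: ler_pM.
- by rewrite !mulr_ge0 ?expR_ge0.
- by rewrite mulr_ge0// ltW.
- by rewrite ler_wpM2l//; apply: ler_pM; rewrite ?mulr_ge0 ?expR_ge0//; apply: ler_pM; rewrite ?expR_ge0.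
- by rewrite ler_wpM2l// ltW.
Qed.

End TubeParameters.

(** * Parameters for the lower bound *)

Section ChainParameters.
Context {R : realType}.

Lemma chain_parameters : exists z0 : R, forall z, z0 <= z ->
  exists N l B : nat, let th : R := pi / B%:R in let tau := z ^- 2 / 20 in
    [/\ (0 < N)%N /\ (0 < l)%N, (1 < B)%N, l.+1%:R * th <= 1,
        1 <= (1 - tau) ^+ 5 * (growth l th / N%:R) &
        l.+2%:R <= N%:R * (expR (-1) + z ^- 2) /\
        2 * expR (- (18 * z)) <= tau ^+ 2 * chain_density l B th / 2].
Proof.
have [|z1 hz1] := @pow_le_expR R (100 ^+ 3) 1 7 _ ltr01; first by rewrite exprn_ge0.
exists (Num.max 64 z1) => z; rewrite ge_max => /andP[z64 /hz1 {hz1} zexp].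
rewrite mul1r in zexp.
have z0 : 0 < z by lra.
pose eta : R := z ^- 2; rewrite -/eta.
have etaz : eta * z ^+ 2 = 1 by rewrite /eta mulVf// expf_neq0// gt_eqF.
have eta0 : 0 < eta by rewrite invr_gt0 exprn_gt0.
have z2 : z <= z ^+ 2 by rewrite expr2 ler_peMl ?(ltW z0)//; lra.
have eta1 : eta * 64 <= 1 by rewrite -[leRHS]etaz ler_wpM2l ?(ltW eta0)// (le_trans z64).
have e4 := @expRN1_ge R; have e2 := @expRN1_le R.
have ee : expR 1 * expR (-1) = 1 :> R by rewrite expRxMexpNx_1.
have E2 := @expR1_ge2 R.
have z20 : 0 <= 16 * z ^+ 2 by rewrite mulr_ge0// exprn_ge0// ltW.
have /andP[N1 N2] := truncnS_bounds z20.
have [N [Ngt0 {}N1 {}N2]] : exists N, [/\ (0 < N)%N, 16 * z ^+ 2 <= N%:R & N%:R <= 16 * z ^+ 2 + 1].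
  by exists (Num.truncn (16 * z ^+ 2)).+1.
have Nr : 0 < N%:R :> R by rewrite ltr0n.
have Neta : 16 <= N%:R * eta by nra.
(* Only half of [eta] goes into [l], which is rounded down; the other half, worth [N eta / 2 >= 8],
   covers the [+ 2] in [l.+2]. *)
have x0 : 0 <= N%:R * (expR (-1) + eta / 2) by rewrite mulr_ge0 ?(ltW Nr)//; lra.
have /andP[l1 l2] := truncn_itv x0.
have [l [{}l1 {}l2]] : exists l : nat, l%:R <= N%:R * (expR (-1) + eta / 2) /\
    N%:R * (expR (-1) + eta / 2) < l%:R + 1.
  by exists (Num.truncn (N%:R * (expR (-1) + eta / 2))); rewrite natr1.
have lz : 3 * z <= l%:R by nra.
have lN : l%:R <= N%:R :> R by apply: le_trans l1 _; rewrite ler_piMr ?(ltW Nr)//; lra.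
have l17 : l%:R <= 17 * z ^+ 2 by lra.
have l0 : (0 < l)%N by rewrite -(ltr_nat R); lra.
have l1r : l.+1%:R = l%:R + 1 :> R by rewrite -natr1.
(* A tube of width about [16 l z] has [l th <= 1 / (4 z)], so killing costs at most [3 eta / 16] per
   step. *)
have B0 : 0 <= 16 * l%:R * z by rewrite !mulr_ge0// ltW.
have /andP[B1 B2] := truncnS_bounds B0.
have [B [{}B1 {}B2]] : exists B : nat, 16 * l%:R * z <= B%:R /\ B%:R <= 16 * l%:R * z + 1.
  by exists (Num.truncn (16 * l%:R * z)).+1.
have lr : 1 <= l%:R :> R by rewrite ler1n.
have lz64 : l%:R * 64 <= l%:R * z :> R by rewrite ler_wpM2l.
have B64 : 64 * 16 * l%:R <= B%:R :> R by lra.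
have Br : 0 < B%:R :> R by lra.
exists N, l, B => th tau.
have pi2 := @pi_ge2 R; have pi4 : pi < 4 :> R by have := @pihalf_lt2 R; lra.
have th0 : 0 < th by rewrite divr_gt0// pi_gt0.
have thB : th * B%:R = pi by rewrite /th divfK// gt_eqF.
have th1 : l.+1%:R * th <= 1.
  by rewrite l1r /th mulrA ler_pdivrMr// mul1r; nra.
have th256 : 256 * th <= 1.
  by rewrite /th mulrA ler_pdivrMr// mul1r; lra.
have tz : l%:R * th * (4 * z) <= 1.
  have : (l%:R * z) * pi <= (l%:R * z) * 4 by rewrite ler_wpM2l ?mulr_ge0 ?(ltW z0) ?(ltW pi4).
  have -> : l%:R * th * (4 * z) = l%:R * z * pi * 4 / B%:R by rewrite /th; ring.
  by rewrite ler_pdivrMr// mul1r; lra.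
have t2 : (l%:R * th) ^+ 2 * 16 <= eta.
  have h : l%:R * th <= (4 * z)^-1 by rewrite -[leRHS]mul1r ler_pdivlMr ?mulr_gt0.
  have -> : eta = ((4 * z)^-1) ^+ 2 * 16 by rewrite /eta; field; rewrite gt_eqF.
  apply: ler_wpM2r => //; apply: lerXn2r => //; rewrite nnegrE.
    by rewrite mulr_ge0 ?(ltW th0).
  by rewrite invr_ge0 mulr_ge0 ?(ltW z0).
clear N1 N2.
have tauE : tau * 20 = eta by rewrite /tau divfK.
have tau0 : 0 < tau by rewrite /tau divr_gt0.
have tau1 : tau <= 1 by lra.
have h5 : 1 - 5 * tau <= (1 - tau) ^+ 5 by apply: expr1B_ge; rewrite (ltW tau0) tau1.
(* A gain of [7 eta / 8] from the choice of [l] against the loss [3 eta / 16]. The result still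
   beats the five factors [1 - eta / 20]. *)
have g : 1 + eta / 2 <= growth l th / N%:R.
  rewrite ler_pdivlMr//; apply: le_trans (growth_ge l0 th0 th1).
  have h1 : (1 + eta * (7 / 8)) * N%:R <= expR 1 * l%:R.
    have h2 : N%:R * (expR (-1) + eta * (7 / 16)) <= l%:R by lra.
    apply: (@le_trans _ _ (expR 1 * (N%:R * (expR (-1) + eta * (7 / 16))))); last first.
      by rewrite ler_wpM2l ?expR_ge0.
    have -> : expR 1 * (N%:R * (expR (-1) + eta * (7 / 16))) =
      (expR 1 * expR (-1) + expR 1 * (eta * (7 / 16))) * N%:R by ring.
    rewrite ee ler_wpM2r ?(ltW Nr)// lerD2l.
    have -> : eta * (7 / 8) = 2 * (eta * (7 / 16)) by field.
    by rewrite ler_wpM2r// mulr_ge0 ?(ltW eta0).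
  have h3 : 1 - eta * (3 / 16) <= 1 - 3 * (l%:R * th) ^+ 2.
    by rewrite lerD2l lerN2; move: t2; move: ((l%:R * th) ^+ 2) => a; lra.
  apply: (@le_trans _ _ ((1 + eta * (7 / 8)) * N%:R * (1 - eta * (3 / 16)))).
    rewrite [leRHS]mulrAC ler_wpM2r ?(ltW Nr)//.
    have : 0 <= eta * (1 - eta * 64) by rewrite mulr_ge0 ?(ltW eta0)// subr_ge0.
    lra.
  apply: ler_pM => //; last by lra.
  by rewrite mulr_ge0 ?(ltW Nr)//; lra.
have B1n : (1 < B)%N by rewrite -(ltr_nat R); lra.
split => //.
- apply: (@le_trans _ _ ((1 - 5 * tau) * (1 + eta / 2))).
    have : 0 <= tau * (1 - eta * 64) by rewrite mulr_ge0 ?(ltW tau0)// subr_ge0.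
    by rewrite -tauE; lra.
  by apply: ler_pM => //; lra.
- split.
    rewrite -[l.+2]addn2 natrD; apply: (@le_trans _ _ (N%:R * (expR (-1) + eta / 2) + 2)); first by lra.
    by lra.
have dens : expR (- (16 * z + 1)) * (th / 2) <= chain_density l B th.
  apply: ler_pM; rewrite ?expR_ge0//; first by rewrite divr_ge0// ltW.
    rewrite expRN -[leRHS]invrK lef_pV2 ?posrE ?expR_gt0 ?invr_gt0 ?exprn_gt0 ?(tilt_gt0 l0 th0 (angle_lt_pi th1))//.
    apply: le_trans (tiltVX_le B l0 th0 th1) _; rewrite ler_expR ler_pdivrMr ?ltr0n//.
    by apply: (le_trans B2); nra.
  have := @sin_ge_cubic R th; rewrite (ltW th0) => h.
  apply: le_trans (h _) ; last by lra.
  have : 0 <= th * th * (1 - 256 * th).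
    by apply: mulr_ge0; [rewrite mulr_ge0 ?(ltW th0)|rewrite subr_ge0].
  have : 0 <= th * (1 - 256 * th) by rewrite mulr_ge0 ?(ltW th0)// subr_ge0.
  lra.
have [K [K273 K500]] : exists K : R, K = 273 /\ K <= 500 by exists 273; split => //; lra.
have K0 : 0 < K by rewrite K273.
have thz : (K * z ^+ 3)^-1 <= th / 2.
  have Bz : B%:R <= K * z ^+ 3.
    apply: (le_trans B2).
    rewrite K273; have -> : 273 * z ^+ 3 = 16 * (17 * z ^+ 2) * z + z ^+ 3 :> R by ring.
    apply: lerD; last by rewrite exprn_ege1//; lra.
    by rewrite ler_wpM2r ?(ltW z0)// ler_wpM2l.
  apply: (@le_trans _ _ (B%:R^-1)).
    by rewrite lef_pV2 ?posrE// mulr_gt0// exprn_gt0.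
  by rewrite /th mulrAC ler_peMl ?invr_ge0 ?(ltW Br)//; lra.
apply: (@le_trans _ _ (tau ^+ 2 * (expR (- (16 * z + 1)) * (K * z ^+ 3)^-1) / 2)); last first.
  rewrite ler_wpM2r ?invr_ge0// ler_wpM2l ?exprn_ge0 ?(ltW tau0)//.
  by apply: le_trans dens; rewrite ler_wpM2l ?expR_ge0.
have -> : tau ^+ 2 * (expR (- (16 * z + 1)) * (K * z ^+ 3)^-1) / 2 =
  expR (- (16 * z + 1)) / (20 * 20 * 2 * (K * z ^+ 7)).
  rewrite /tau /eta; move: (expR _) => X; move: z0 K0; clear => z0 K0.
  by field; rewrite !gt_eqF.
have K7 : 0 < K * z ^+ 7 by rewrite mulr_gt0// exprn_gt0.
rewrite ler_pdivlMr; last by rewrite !mulr_gt0.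
(* Weakening the exponent [16 z + 1] to [18 z] frees [exp z] for the polynomial and
   [exp (z - 1) >= 1]. *)
have -> : expR (- (16 * z + 1)) = expR (- (18 * z)) * (expR z * expR (z - 1)).
  by rewrite -!expRD; congr expR; lra.
have -> : 2 * expR (- (18 * z)) * (20 * 20 * 2 * (K * z ^+ 7)) =
  expR (- (18 * z)) * ((2 * 20 * 20 * 2 * K) * z ^+ 7 * 1) by ring.
rewrite ler_wpM2l ?expR_ge0//.
apply: ler_pM => //.
- apply: mulr_ge0; last by rewrite exprn_ge0// ltW.
  by apply: mulr_ge0; [rewrite !mulr_ge0|exact: ltW].
- apply: le_trans zexp; rewrite ler_wpM2r ?exprn_ge0 ?(ltW z0)//.
  have -> : 100 ^+ 3 = 100 * 20 * 500 :> R by ring.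
  by apply: ler_pM; rewrite ?mulr_ge0 ?(ltW K0)//; lra.
- apply: le_trans (expR_ge1Dx _); lra.
Qed.

End ChainParameters.

(** * Exponential tail bounds for the two sides *)

Section Window.
Context {d : measure_display} {T : measurableType d} {R : realType} (P : probability T R).
Variables (n : nat) (W : edge n -> {RV P >-> R}).
Hypotheses (indW : mutually_independent W) (expW : forall e, exp_distributed (W e) n%:R)
  (n1 : (1 < n)%N).

Lemma Lmax_gt_probability (lam delta : R) N l D L :
  (0 < N)%N -> (0 < L)%N -> (0 < l <= D)%N -> 0 <= delta -> N%:R * lam <= l%:R ->
  (forall p : 'I_(l + D.*2).+1 -> R, (forall k, 0 <= p k) ->
    (forall k : 'I_(l + D.*2).+1, (k < l + D.*2)%N -> n%:R * p k <= N%:R^-1) ->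
    expR 1 * low_weight n l D.*2 p L (l + D) <= delta / (6 * L%:R)) ->
  exists2 B : set T, measurable B /\ (P B <= (expR (1 - delta / (6 * L%:R) * n%:R))%:E)%E &
    forall om, (forall e, 0 <= W e om) -> ~ B om ->
      (Lmax (fun e => W e om) lam)%:R <= n%:R * delta.
Proof.
move=> N0 L0 lD d0 Nlam hlow.
have Lr : 0 < L%:R :> R by rewrite ltr0n.
pose J := (l + D.*2)%N; pose K := Num.truncn (n%:R * delta).
pose bad (w : {ffun edge n -> 'I_J.+1}) := `[< exists v s,
  [/\ uniq (v :: map fst s), follows w (labelled_edges v s),
      (label_sum s <= l * size s)%N & (K < size s)%N] >].
have nd0 : 0 <= n%:R * delta by rewrite mulr_ge0.
have /andP[K1 K2] := truncn_itv nd0; rewrite -/K in K1 K2.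
(* Up to an error of 1, [M] is at least twice [n delta / (6 L)], while the expected number of low
   segments, weighted by [e], is at most once that. *)
pose M := (K %/ (3 * L))%N.
have MK : (3 * M * L <= K)%N.
  by rewrite mulnAC mulnC leq_divM.
have M1 : n%:R * delta / (3 * L%:R) - 1 <= M%:R.
  rewrite lerBlDr natr1 ler_pdivrMr ?mulr_gt0// -natrM -natrM; apply: (le_trans (ltW K2)).
  by rewrite ler_nat ltn_ceil// muln_gt0.
exists [set om | bad (discretized N J W om)]; first split.
- exact: measurable_discretized.
- rewrite discretized_prob// lee_fin.
  apply: le_trans (_ : _ <= expR (n%:R * (expR 1 * low_weight n l D.*2 (cell_prob n N (J := J)) L (l + D)) - M%:R)) _.
    apply: (product_prob_long_path (cell_prob_ge0 n N (J := J)) (cell_prob_sum J expW n1 N0) L0 lD erefl).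
    move=> w /asboolP[v [s [us fw ls Ks]]]; exists v, s; split => //.
    exact: leq_ltn_trans MK Ks.
  rewrite ler_expR.
  have := hlow (cell_prob n N (J := J)) (cell_prob_ge0 n N (J := J)) (cell_prob_le expW n1 N0 (J := J)).
  move: (expR 1 * _) => X hX.
  have : n%:R * X <= n%:R * (delta / (6 * L%:R)) by rewrite ler_wpM2l.
  have : n%:R * delta / (3 * L%:R) = 2 * (n%:R * (delta / (6 * L%:R))).
    by field; rewrite gt_eqF.
  move: M1; rewrite [delta / _ * n%:R]mulrC; lra.
- move=> om W0 nbad; apply: le_trans K1; rewrite ler_nat.
  apply: (Lmax_le_of_discretized (N := N) (dw := discretized N J W om) _ W0 Nlam).
    by move=> e; rewrite ffunE.
  by move=> h; apply: nbad; apply/asboolP.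
Qed.

Lemma Lmax_lt_probability (lam tau delta : R) N l B : let th : R := pi / B%:R in
  (0 < N)%N -> (0 < l)%N -> (1 < B)%N -> l.+1%:R * th <= 1 ->
  0 < tau -> 2 * tau <= 1 -> 1 <= (1 - tau) ^+ 5 * (growth l th / N%:R) ->
  l.+2%:R <= N%:R * lam -> 2 * delta <= tau ^+ 2 * chain_density l B th / 2 ->
  (l + B)%:R <= tau * n%:R -> (l + B + 3)%:R <= n%:R * delta ->
  exists2 A : set T,
    measurable A /\ (P A <= (expR (- (tau ^+ 3 * chain_density l B th / 2 * n%:R)))%:E)%E &
    forall om, ~ A om -> n%:R * delta <= (Lmax (fun e => W e om) lam)%:R.
Proof.
move=> th N0 l0 B1 th1 tau0 tau1 super lamN dens Jn nd.
have Br : 0 < B%:R :> R by rewrite ltr0n ltnW.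
have th0 : 0 < th by rewrite divr_gt0// pi_gt0.
have Bpi : B%:R * th = pi by rewrite mulrC divfK// gt_eqF.
pose J := (l + B)%N; set m0 := chain_length n l B th tau.
pose bad (w : {ffun edge n -> 'I_J.+1}) := `[< ~ exists st : seq ('I_n * (nat * nat)),
     [/\ uniq (map fst st), all (fun a => in_tube l (l + B) a.2.1) st,
         chain l w st & (m0 <= size st)%N] >].
exists [set om | bad (discretized N J W om)]; first split.
- exact: measurable_discretized.
- rewrite discretized_prob// lee_fin.
  apply: (product_prob_no_chain (N := N) (J := J) (cell_prob_ge0 n N (J := J)) (cell_prob_sum J expW n1 N0)) => //.
  exact: cell_prob_ge.
- move=> om nbad.
  have dens' : tau ^+ 2 * chain_density l B th * n%:R / 2 =
    tau ^+ 2 * chain_density l B th / 2 * n%:R by rewrite mulrAC.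
  have q0 : 0 <= tau ^+ 2 * chain_density l B th * n%:R / 2.
    rewrite dens' mulr_ge0//; apply: le_trans dens.
    by rewrite mulr_ge0// -(pmulr_rge0 _ (_ : 0 < n%:R)) ?ltr0n ?(ltnW n1)// (le_trans _ nd).
  have m0nd : 2 * (n%:R * delta) < m0.+1%:R.
    have /andP[_ h] := truncn_itv q0; apply: le_lt_trans h.
    by rewrite dens' mulrCA mulrC ler_wpM2r.
  (* The second copy of [n delta] covers [l + B] and the roundings. The path is thus longer than the
     tube is high, and one more unit per edge, from [l.+1] to [l.+2], pays for the initial
     height. *)
  have m0big : n%:R * delta + (l + B)%:R + 1 <= m0.-1%:R.
    have m0pos : (0 < m0)%N.
      rewrite -ltnS -(ltr_nat R); apply: le_lt_trans m0nd.
      by rewrite natrD in nd; have := ler0n R (l + B); lra.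
    move: m0nd nd; rewrite -{1}(prednK m0pos) !natrD -!natr1 => h1 h2; lra.
  apply: (le_trans _ (_ : m0.-1%:R <= _)).
    by have := ler0n R (l + B); lra.
  have {}nbad : exists st : seq ('I_n * (nat * nat)),
     [/\ uniq (map fst st), all (fun a => in_tube l (l + B) a.2.1) st,
         chain l (discretized N J W om) st & (m0 <= size st)%N].
    by apply: contrapT => h; apply: nbad; apply/asboolP.
  case: nbad => st [us tube ch mst].
  have lB1 : (l + B < m0.-1)%N.
    have nd0 : 0 <= n%:R * delta by exact: le_trans nd.
    by rewrite -(ltr_nat R); apply: lt_le_trans m0big; rewrite addrAC ltrDr ltr_wpDl.
  rewrite ler_nat.
  apply: (Lmax_ge_of_chain (N := N) (J := J) N0 (fun e => ffunE _ e) (leqnn _) us tube ch).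
  + by rewrite mst andbT; move: lB1; clear; lia.
  + move=> m mm; rewrite mulrA; apply: (@le_trans _ _ (l.+2%:R * m%:R)); last by rewrite ler_wpM2r.
    by rewrite -natrM ler_nat; move: (leq_trans (ltnW lB1) mm); clear; lia.
Qed.

End Window.

(** * Passage to the limit *)

Section Limit.
Context {R : realType}.

Lemma cvg_expR_linear (a c : R) : 0 < c ->
  (fun n : nat => expR (a - c * n%:R) : R^o) @ \oo --> (0 : R^o).
Proof.
move=> c0; have -> : (fun n : nat => expR (a - c * n%:R)) =
    (fun n : nat => expR a * expR (- c) ^+ n).
  by apply/funext => n; rewrite -expRM_natr -expRD mulNr.
rewrite -[X in _ --> X](mulr0 (expR a)); apply: cvgMr.
apply: cvg_expr; rewrite ger0_norm ?expR_ge0// expR_lt1.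
by rewrite oppr_lt0.
Qed.

End Limit.

Theorem theorem1p1 (R : realType) :
  exists C1 C2 eta_star : R, [/\ 0 < C1, 0 < C2, 0 < eta_star &
    forall eta : R, 0 < eta -> eta <= eta_star ->
    forall (d : measure_display) (T : measurableType d) (P : probability T R)
           (W : forall n : nat, edge n -> {RV P >-> R}),
      (forall n : nat, mutually_independent (W n)) ->
      (forall (n : nat) (e : edge n), exp_distributed (W n e) n%:R) ->
      let lam := expR (-1) + eta in
      (fun n : nat => fine (P [set om : T |
          n%:R * expR (- C1 / Num.sqrt eta) <= (Lmax (fun e => W n e om) lam)%:R
          <= n%:R * expR (- C2 / Num.sqrt eta)])) @ \oo --> (1 : R^o)].
Proof.
have [z1 hz1] := @low_weight_parameters R; have [z2 hz2] := @chain_parameters R.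
pose zs := Num.max 1 (Num.max z1 z2).
have zs1 : 1 <= zs by rewrite le_max lexx.
have zs0 : 0 < zs by exact: lt_le_trans zs1.
(* The exponents reached by the two parameter choices; [eta <= zs ^- 2] says that [z = 1 / sqrt eta]
   exceeds both thresholds and 1. *)
exists 18, (128^-1), (zs ^- 2); split; rewrite ?invr_gt0 ?ltr0n ?exprn_gt0//.
move=> eta eta0 etas d T P W indW expW lam.
pose z := (Num.sqrt eta)^-1.
have s0 : 0 < Num.sqrt eta by rewrite sqrtr_gt0.
have z2eta : z ^- 2 = eta by rewrite /z exprVn invrK sqr_sqrtr// ltW.
have zsz : zs <= z.
  rewrite /z -[leLHS]invrK lef_pV2 ?posrE ?invr_gt0//.
  rewrite -(@ler_pXn2r _ 2) ?nnegrE ?sqrtr_ge0 ?invr_ge0 ?(ltW zs0)//.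
  by rewrite sqr_sqrtr ?(ltW eta0)// exprVn.
have zz1 : z1 <= z by apply: le_trans zsz; rewrite !le_max lexx orbT.
have zz2 : z2 <= z by apply: le_trans zsz; rewrite !le_max lexx !orbT.
have zge1 : 1 <= z by exact: le_trans zsz.
have [N1 [l1 [D [L [N10 L0 lD lam1 low]]]]] := hz1 z zz1.
have [N2 [l2 [B [[N20 l20] B1 th1 super [lam2 dens]]]]] := hz2 z zz2.
rewrite z2eta -/lam in lam1 lam2; rewrite z2eta in super dens.
set th : R := pi / B%:R in th1 super dens; set tau := eta / 20 in super dens.
have etale1 : eta <= 1.
  by rewrite -z2eta invf_le1 ?exprn_ege1// exprn_gt0// (lt_le_trans _ zge1).
have tau0 : 0 < tau by rewrite divr_gt0.
have tau1 : 2 * tau <= 1 by rewrite /tau; lra.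
pose delta2 := expR (- (z / 128)); pose delta1 := expR (- (18 * z)).
have Lr : 0 < L%:R :> R by rewrite ltr0n.
pose k2 := delta2 / (6 * L%:R); pose k1 := tau ^+ 3 * chain_density l2 B th / 2.
have k20 : 0 < k2 by rewrite divr_gt0 ?expR_gt0 ?mulr_gt0.
have q0 : 0 < tau ^+ 2 * chain_density l2 B th / 2.
  by apply: lt_le_trans dens; rewrite mulr_gt0 ?expR_gt0.
have k10 : 0 < k1.
  have -> : k1 = tau * (tau ^+ 2 * chain_density l2 B th / 2) by rewrite /k1 exprS !mulrA.
  exact: mulr_gt0.
have E1 : - 18 / Num.sqrt eta = - (18 * z) by rewrite mulNr.
have E2 : - 128^-1 / Num.sqrt eta = - (z / 128) by rewrite mulNr mulrC.
rewrite E1 E2 -/delta1 -/delta2.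
(* The rates [k1] and [k2] depend on [eta] but not on [n], so both tails vanish in the limit. *)
pose err n : R := expR (1 - k2 * n%:R) + expR (0 - k1 * n%:R).
have main n : (1 < n)%N -> (l2 + B)%:R <= tau * n%:R -> (l2 + B + 3)%:R <= n%:R * delta1 ->
  1 - err n <= fine (P [set om | n%:R * delta1 <= (Lmax (fun e => W n e om) lam)%:R <= n%:R * delta2]) <= 1.
  move=> n1 Jn nd; set E := [set om | _].
  have mE : measurable E.
    exact: (measurable_Lmax (W n) lam (fun m : nat => n%:R * delta1 <= m%:R <= n%:R * delta2)).
  have PE1 : (P E <= 1)%E by exact: probability_le1.
  have PEfin : P E \is a fin_num by exact: fin_num_measure.
  have [Bu [mBu PBu] hBu] := Lmax_gt_probability (indW n) (expW n) n1 N10 L0 lD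
    (expR_ge0 _) lam1 (low n).
  have [Bl [mBl PBl] hBl] := Lmax_lt_probability (indW n) (expW n) n1 N20 l20 B1 th1 tau0 tau1
    super lam2 dens Jn nd.
  have mneg : measurable [set om | exists e, W n e om < 0].
    have -> : [set om | exists e, W n e om < 0] =
        \bigcup_(e in [set: edge n]) (W n e @^-1` `]-oo, 0[%classic).
      apply/seteqP; split=> om /= [e]; first by exists e => //=; rewrite in_itv.
      by move=> _; rewrite /= in_itv/= => h; exists e.
    apply: fin_bigcup_measurable => [|e _]; last exact: measurable_funPTI.
    exact: (@finite_finset (edge n : finType)).
  (* The upper bound is available only for nonnegative weights, so the null event of a negative
     weight joins the two exceptional sets. *)
  have sub : ~` E `<=` [set om | exists e, W n e om < 0] `|` (Bu `|` Bl).
    move=> om nE; apply: contrapT => /not_orP[nneg /not_orP[nBu nBl]]; apply: nE => /=.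
    have W0 e : 0 <= W n e om by rewrite leNgt; apply/negP => h; apply: nneg; exists e.
    by apply/andP; split; [exact: hBl|exact: hBu].
  have PC : (P (~` E) <= (err n)%:E)%E.
    apply: (@le_trans _ _ (P ([set om | exists e, W n e om < 0] `|` (Bu `|` Bl)))).
      apply: le_measure; rewrite ?inE//; first exact: measurableC.
      by apply: measurableU => //; exact: measurableU.
    apply: le_trans (measureU2 P mneg (measurableU _ _ mBu mBl)) _.
    rewrite -[leRHS]add0e -(discretized_negative (expW n)); apply: leeD => //.
    apply: le_trans (measureU2 P mBu mBl) _.
    by rewrite /err EFinD sub0r; apply: leeD; rewrite // mulrC.
  apply/andP; split; last by rewrite -lee_fin fineK.
  rewrite lerBlDr -lerBlDl -lee_fin EFinB fineK//.
  by rewrite -probability_setC.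
have cerr : (fun n => 1 - err n : R^o) @ \oo --> (1 : R^o).
  rewrite -[X in _ --> X]subr0; apply: cvgB; first exact: cvg_cst.
  rewrite -[X in _ --> X]addr0; apply: cvgD; exact: cvg_expR_linear.
apply: (@squeeze_cvgr _ _ _ _ (fun n => 1 - err n : R^o) (fun=> 1 : R^o)) => //; last exact: cvg_cst.
have d10 : 0 < delta1 by exact: expR_gt0.
near=> n; apply: main.
- by near: n; exact: nbhs_infty_gt.
- rewrite mulrC -ler_pdivrMr//; near: n; exact: nbhs_infty_ger.
- rewrite -ler_pdivrMr//; near: n; exact: nbhs_infty_ger.
Unshelve. all: by end_near.
Qed.
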